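(* Let $n = \dim\mathbb{E} \geq 2$. Let $f : \mathbb{E}\to\mathbb{R}$ be a twice differentiable function with positive definite Hessian that is strongly self-concordant with constant $M \ge 0$, and let $\mu, L > 0$ be such that $\mu B \preceq \nabla^2 f(x) \preceq LB$ for all $x \in \mathbb{E}$. Let $(x_k)_{k\ge0}$, $(G_k)_{k\ge0}$ be generated by the quasi-Newton scheme described in the context, where for each $k\geq0$ we take $u_k = \bar{u}_{x_{k+1}}(G_k)$ (with arbitrary $\tau_k\in[0,1]$). Suppose that the initial point $x_0$ is sufficiently close to the solution: $$M\lambda_f(x_0) \leq \frac{\ln 2}{4(2n+1)}\,\frac{\mu}{L}.$$ Then, for all $k\geq0$, we have $$\nabla^2 f(x_k) \preceq G_k \preceq \left(1 + \left(1-\frac{\mu}{nL}\right)^k\frac{2nL}{\mu}\right)\nabla^2 f(x_k),$$ and $$\lambda_f(x_{k+1}) \leq \left(1-\frac{\mu}{nL}\right)^k\frac{2nL}{\mu}\cdot\lambda_f(x_k).$$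
   Context: $\mathbb{E}$ is an $n$-dimensional real vector space, $\mathbb{E}^*$ its dual, and $\langle s, x\rangle$ is the value of $s \in \mathbb{E}^*$ at $x \in \mathbb{E}$. The gradient $\nabla f(x)$ belongs to $\mathbb{E}^*$ and the Hessian $\nabla^2 f(x)$ is a self-adjoint linear operator $\mathbb{E}\to\mathbb{E}^*$. For self-adjoint $A, A_1 : \mathbb{E} \to \mathbb{E}^*$, $A \preceq A_1$ means $\langle (A_1 - A)h, h\rangle \ge 0$ for all $h \in \mathbb{E}$. For $x, h\in\mathbb{E}$, $\|h\|_x = \langle\nabla^2 f(x)h,h\rangle^{1/2}$. The local norm of the gradient is $\lambda_f(x) = \langle\nabla f(x),\nabla^2 f(x)^{-1}\nabla f(x)\rangle^{1/2}$. For $u \in \mathbb{E}$, $u^*$ denotes the map $s \mapsto \langle s, u\rangle$ on $\mathbb{E}^*$; thus $uu^* : \mathbb{E}^*\to\mathbb{E}$ is $s \mapsto \langle s,u\rangle u$, and e.g. $Auu^*G$ is the operator $\mathbb{E}\to\mathbb{E}^*$, $h \mapsto \langle Gh, u\rangle Au$. A basis $e_1,\dots,e_n$ of $\mathbb{E}$ is fixed, and $B = \left(\sum_{i=1}^n e_ie_i^*\right)^{-1} : \mathbb{E}\to\mathbb{E}^*$. A twice differentiable function $f : \mathbb{E}\to\mathbb{R}$ with positive definite Hessian is strongly self-concordant with constant $M \ge 0$ if $$\nabla^2 f(y) - \nabla^2 f(x) \preceq M\|y-x\|_z\,\nabla^2 f(w)\quad\text{for all } x,y,z,w\in\mathbb{E}.$$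 For self-adjoint positive definite $A$, self-adjoint $G$ with $A \preceq G$, $u \in \mathbb{E}$ and $\tau \in \mathbb{R}$: if $Gu \ne Au$, define $$\mathrm{Broyd}_\tau(G,A,u) = \tau\left[G - \frac{Auu^*G + Guu^*A}{\langle Au,u\rangle} + \left(\frac{\langle Gu,u\rangle}{\langle Au,u\rangle}+1\right)\frac{Auu^*A}{\langle Au,u\rangle}\right] + (1-\tau)\left[G - \frac{(G-A)uu^*(G-A)}{\langle (G-A)u,u\rangle}\right],$$ and if $Gu = Au$, define $\mathrm{Broyd}_\tau(G,A,u) = G$. Greedy direction: for $x \in \mathbb{E}$ and self-adjoint $G$, $\bar{u}_x(G) = \operatorname*{argmax}_{u\in\{e_1,\dots,e_n\}}\frac{\langle Gu,u\rangle}{\langle\nabla^2 f(x)u,u\rangle}$, i.e. any basis vector attaining the maximum. Quasi-Newton scheme: choose $x_0 \in \mathbb{E}$ and set $G_0 = LB$. For $k \ge 0$: (1) $x_{k+1} = x_k - G_k^{-1}\nabla f(x_k)$; (2) compute $r_k = \|x_{k+1}-x_k\|_{x_k}$ and set $\tilde{G}_k = (1+Mr_k)G_k$; (3) choose $u_k\in\mathbb{E}$ and $\tau_k\in[0,1]$; (4) $G_{k+1} = \mathrm{Broyd}_{\tau_k}(\tilde{G}_k,\nabla^2 f(x_{k+1}),u_k)$. (The scheme is well-defined, since $\nabla^2 f(x_{k+1}) \preceq \tilde{G}_k$ for all $k$.) *)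

(* Defs.v *)
From HB Require Import structures.
From mathcomp Require Import all_boot all_order all_algebra.
From mathcomp Require Import all_classical all_reals all_analysis.

Set Implicit Arguments.
Unset Strict Implicit.
Unset Printing Implicit Defensive.

Import Order.TTheory GRing.Theory Num.Theory.
Import numFieldNormedType.Exports.

Local Open Scope ring_scope.

(* A finite-dimensional space E is a [vectType R], its dual E^* is
   ['Hom(E, R^o)], and <s, x> is the application [s x]; an operator
   A : E -> E^* is an element of ['Hom(E, 'Hom(E, R^o))], so that <A h, v>
   is [A h v]. *)

(* [vectType] carries no topology.  [normed V] is V with the l1 norm of the
   coordinates in some basis; all norms on V being equivalent, differentiability
   and differentials do not depend on this choice. *)
Definition normed (R : realType) (V : vectType R) : Type := V.

Section Normed.
Context (R : realType) (V : vectType R).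

HB.instance Definition _ := Vector.copy (normed V) V.

Definition coord_norm (x : normed V) : R :=
  \sum_(i < \dim {:V}) `|coord (vbasis {:V}) i (x : V)|.

Fact coord_normD (x y : normed V) :
  coord_norm (x + y) <= coord_norm x + coord_norm y.
Proof.
rewrite /coord_norm -big_split /=; apply: ler_sum => i _.
by rewrite [coord _ _ _]linearD ler_normD.
Qed.

Fact coord_normZ (a : R) (x : normed V) :
  coord_norm (a *: x) = `|a| * coord_norm x.
Proof.
rewrite /coord_norm mulr_sumr; apply: eq_bigr => i _.
by rewrite [coord _ _ _]linearZ normrM.
Qed.

Fact coord_norm_eq0 (x : normed V) : coord_norm x = 0 -> x = 0.
Proof.
move=> x0; have cx i : coord (vbasis {:V}) i (x : V) = 0.
  apply/eqP; rewrite -normr_le0 -x0 /coord_norm (bigD1 i) //= lerDl.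
  by apply: sumr_ge0.
rewrite (coord_vbasis (memvf (x : V)) : x = _) big1 // => i _.
by rewrite cx scale0r.
Qed.

HB.instance Definition _ :=
  Lmodule_isNormed.Build R (normed V) coord_normD coord_normZ coord_norm_eq0.

End Normed.

Section SelfConcordance.
Context (R : realType) (E : vectType R).
Implicit Types (f : E -> R) (x y z w h u : E) (A G : 'Hom(E, 'Hom(E, R^o))).

Definition gradient f x : 'Hom(E, R^o) :=
  linfun ('d (f : normed E -> R^o) (x : normed E)).

Definition hessian f x : 'Hom(E, 'Hom(E, R^o)) :=
  linfun ('d (gradient f : normed E -> normed 'Hom(E, R^o)) (x : normed E)).

Definition twice_differentiable f :=
  (forall x, differentiable (f : normed E -> R^o) (x : normed E)) /\
  (forall x, differentiable
     (gradient f : normed E -> normed 'Hom(E, R^o)) (x : normed E)).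

Lemma gradientE f x h : gradient f x h = 'd (f : normed E -> R^o) (x : normed E) h.
Proof. exact: (lfunE ('d (f : normed E -> R^o) (x : normed E))). Qed.

Lemma hessianE f x h :
  hessian f x h =
  'd (gradient f : normed E -> normed 'Hom(E, R^o)) (x : normed E) h.
Proof.
exact: (lfunE
  ('d (gradient f : normed E -> normed 'Hom(E, R^o)) (x : normed E))).
Qed.

Definition loewner_le A G := forall h, 0 <= (G - A) h h.

Definition posdef A := forall h, h != 0 -> 0 < A h h.

Definition local_norm f x h : R := Num.sqrt (hessian f x h h).

(* [(_ ^-1)%VF] is the inverse of an invertible linear map. *)
Definition gradient_norm f x : R :=
  Num.sqrt (gradient f x ((hessian f x)^-1%VF (gradient f x))).

Definition strongly_self_concordant (M : R) f := forall x y z w,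
  loewner_le (hessian f y - hessian f x)
             ((M * local_norm f z (y - x)) *: hessian f w).

(* u u^* : E^* -> E *)
Definition uustar_fun u (s : 'Hom(E, R^o)) : E := (s u : R) *: u.

Fact uustar_fun_is_linear u : linear (uustar_fun u).
Proof.
by move=> a s t; rewrite /uustar_fun !lfunE /= lfunE /= scalerDl scalerA.
Qed.

HB.instance Definition _ u := GRing.isLinear.Build R 'Hom(E, R^o) E _
  (uustar_fun u) (uustar_fun_is_linear u).

Definition uustar u : 'Hom('Hom(E, R^o), E) := linfun (uustar_fun u).

Lemma uustarE u (s : 'Hom(E, R^o)) : uustar u s = (s u : R) *: u.
Proof. exact: lfunE. Qed.

Definition basis_operator n (e : n.-tuple E) : 'Hom(E, 'Hom(E, R^o)) :=
  ((\sum_(i < n) uustar (tnth e i))^-1)%VF.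

Definition Broyd (tau : R) G A u : 'Hom(E, 'Hom(E, R^o)) :=
  if G u == A u then G else
    tau *: (G - (A u u)^-1 *: ((A \o uustar u \o G) + (G \o uustar u \o A))%VF
              + ((G u u / A u u + 1) / A u u) *: (A \o uustar u \o A)%VF)
    + (1 - tau) *: (G - ((G - A) u u)^-1 *: ((G - A) \o uustar u \o (G - A))%VF).

Definition greedy_direction n (e : n.-tuple E) f x G u :=
  u \in e /\
  forall v, v \in e -> G v v / hessian f x v v <= G u u / hessian f x u u.

Definition quasi_newton (M L : R) n (e : n.-tuple E) f
    (x : nat -> E) (G : nat -> 'Hom(E, 'Hom(E, R^o)))
    (u : nat -> E) (tau : nat -> R) :=
  G 0%N = L *: basis_operator e /\
  forall k : nat,
    [/\ x k.+1 = x k - (G k)^-1%VF (gradient f (x k)),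
        0 <= tau k <= 1 &
        G k.+1 = Broyd (tau k)
                   ((1 + M * local_norm f (x k) (x k.+1 - x k)) *: G k)
                   (hessian f (x k.+1)) (u k)].

End SelfConcordance.

(* Main.v *)
Require Import Defs.
From HB Require Import structures.
From mathcomp Require Import all_boot all_order all_algebra.
From mathcomp Require Import all_classical all_reals all_analysis.
From mathcomp Require Import ring lra zify.
Import Order.TTheory GRing.Theory Num.Theory.
Import numFieldNormedType.Exports.
Local Open Scope ring_scope.

(** Write A_k for the Hessian at x_k and lambda_k for the local norm of the
    gradient there.  Two quantities measure how far G_k is from A_k: a number
    eta_k with A_k <= G_k <= eta_k A_k, and
      sigma_k = tr (A_k^-1 (G_k - A_k)),
    which satisfies G_k <= (1 + sigma_k) A_k because every eigenvalue of a
    positive operator is at most its trace ([le_rel_trace]).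

    The Broyden update.  Relative to its target A the operator never leaves the
    interval [A, eta A] ([Broyd_ge], [Broyd_le]), and its trace drops by at least
    the relative excess of G over A in the direction u
    ([rel_trace_Broyd_le]).  The greedy direction maximises this
    excess over the basis; summing over the basis gives the trace relative to B,
    and mu B <= A <= L B turns it into the trace relative to A, so that sigma is
    multiplied by at most rho = 1 - mu / (n L) ([rel_trace_le_max_ratio]).

    The gradient step.  If A <= G <= eta A then, with a = M lambda / 2,
      lambda_+ <= (1 + a) (1 - 1 / eta + a) lambda   ([newton_step_decrease]):
    the factor 1 - 1 / eta is the error made by replacing A^-1 with G^-1, and
    the terms in a come from the variation of the Hessian between the
    two points, controlled by strong self-concordance.  The same
    variation moves the target of the update, at the price of factors
    1 + M r_k <= exp (M lambda_k) in eta and sigma.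

    Closing the loop.  As long as eta_k <= (3/2) L / mu, the gradient norms decrease
    at the linear rate 1 - mu / (2 L), so that their sum is at most
    (2 L / mu) lambda_0; the assumption on x_0 then keeps the accumulated factors
    exp (2 M sum lambda_i) small enough for the bound on eta to persist.
    Finally theta_k = sigma_k + 2 n M lambda_k satisfies
      theta_(k+1) <= rho exp (2 (2 n + 1) M lambda_k) theta_k   ([potential_step]),
    the total exponential factor is at most 2, and theta_0 <= n L / mu.  Both
    conclusions follow, as sigma_k <= theta_k and
    lambda_(k+1) <= theta_k lambda_k.

    The operators are handled without coordinates.  The fact behind all trace
    inequalities is that a positive operator is a sum of squares of functionals
    ([psd_sum_squares]).  The Hessian is self-adjoint by the classical argument with
    second differences ([selfadjoint_hessian]). *)

Set Implicit Arguments.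
Unset Strict Implicit.

(** * Positive operators and the relative trace *)
Section Operators.
Context (R : realType) (E : vectType R).
Implicit Types (x y h u v w : E) (s a : 'Hom(E, R^o)).
Implicit Types (A G P : 'Hom(E, 'Hom(E, R^o))) (c t : R).

(** The bracket of a functional and a vector, with value type [R] rather than
    [R^o], kept as a constant of its own so that ordered-field reasoning sees
    plain real numbers. *)
Definition pr s u : R := s u.

Lemma prDl s a u : pr (s + a) u = pr s u + pr a u.
Proof. exact: lfunE. Qed.
Lemma prZl c s u : pr (c *: s) u = c * pr s u.
Proof. by rewrite /pr lfunE. Qed.
Lemma prNl s u : pr (- s) u = - pr s u.
Proof. exact: lfunE. Qed.
Lemma prBl s a u : pr (s - a) u = pr s u - pr a u.
Proof. by rewrite prDl prNl. Qed.
Lemma pr0l u : pr 0 u = 0.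
Proof. exact: lfunE. Qed.
Lemma prDr s u v : pr s (u + v) = pr s u + pr s v.
Proof. exact: linearD. Qed.
Lemma prZr c s u : pr s (c *: u) = c * pr s u.
Proof. exact: linearZ. Qed.
Lemma prNr s u : pr s (- u) = - pr s u.
Proof. exact: linearN. Qed.
Lemma prBr s u v : pr s (u - v) = pr s u - pr s v.
Proof. exact: linearB. Qed.
Lemma pr0r s : pr s 0 = 0.
Proof. exact: linear0. Qed.
Lemma pr_suml (I : Type) (r : seq I) (F : I -> 'Hom(E, R^o)) u :
  pr (\sum_(i <- r) F i) u = \sum_(i <- r) pr (F i) u.
Proof. by rewrite /pr sum_lfunE. Qed.
Lemma pr_sumr (I : Type) (r : seq I) (F : I -> E) s :
  pr s (\sum_(i <- r) F i) = \sum_(i <- r) pr s (F i).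
Proof. exact: linear_sum. Qed.

Lemma opD A G u : (A + G) u = A u + G u. Proof. exact: lfunE. Qed.
Lemma opN A u : (- A) u = - A u. Proof. exact: lfunE. Qed.
Lemma opB A G u : (A - G) u = A u - G u. Proof. by rewrite opD opN. Qed.
Lemma opZ c A u : (c *: A) u = c *: A u. Proof. exact: lfunE. Qed.

Definition prE := (opD, opZ, opN, prDl, prZl, prNl, prDr, prZr, prNr).

Lemma pr_opD A G h v : pr ((A + G) h) v = pr (A h) v + pr (G h) v.
Proof. by rewrite opD prDl. Qed.
Lemma pr_opB A G h v : pr ((A - G) h) v = pr (A h) v - pr (G h) v.
Proof. by rewrite opB prBl. Qed.
Lemma pr_opZ c A h v : pr ((c *: A) h) v = c * pr (A h) v.
Proof. by rewrite opZ prZl. Qed.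

Lemma dyadE A G u h : (A \o uustar u \o G)%VF h = pr (G h) u *: A u.
Proof. by rewrite !comp_lfunE uustarE linearZ. Qed.

Definition selfadjoint A := forall u v, pr (A u) v = pr (A v) u.
Definition psd A := forall h, 0 <= pr (A h) h.

Lemma loewnerP A G :
  loewner_le A G <-> forall h, pr (A h) h <= pr (G h) h.
Proof.
split=> H h; move: (H h).
  by rewrite -[X in _ <= X]/(pr ((G - A) h) h) pr_opB subr_ge0.
by rewrite -[X in _ -> _ <= X]/(pr ((G - A) h) h) pr_opB subr_ge0.
Qed.

Lemma posdefP A h : posdef A -> h != 0 -> 0 < pr (A h) h.
Proof. exact. Qed.

Lemma posdef_psd A : posdef A -> psd A.
Proof.
move=> Ap h; have [->|/(posdefP Ap)/ltW//] := eqVneq h 0; by rewrite pr0r.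
Qed.

Lemma posdef_le A G : posdef A -> loewner_le A G -> posdef G.
Proof.
by move=> Ap /loewnerP AG h /(posdefP Ap) Ah; apply: (lt_le_trans Ah); exact: AG.
Qed.

Lemma selfadjointB A G : selfadjoint A -> selfadjoint G -> selfadjoint (G - A).
Proof. by move=> As Gs u v; rewrite !pr_opB As Gs. Qed.
Lemma selfadjointZ c A : selfadjoint A -> selfadjoint (c *: A).
Proof. by move=> As u v; rewrite !pr_opZ As. Qed.

(** Only semidefiniteness is available, so the discriminant argument has a
    degenerate case. *)
Lemma cauchy_schwarz P : selfadjoint P -> psd P ->
  forall u v, pr (P u) v ^+ 2 <= pr (P u) u * pr (P v) v.
Proof.
move=> Ps Pp u v.
(* the quadratic is evaluated at its minimum if c > 0; if c = 0 and b <> 0, at a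
   point where the remaining affine function equals -1 *)
have q t : 0 <= pr (P u) u + t * pr (P u) v *+ 2 + t ^+ 2 * pr (P v) v.
  by have := Pp (u + t *: v); rewrite linearD linearZ !prE (Ps v u); lra.
move: (q (- pr (P u) v / pr (P v) v)) (q (- (pr (P u) u + 1) / (2 * pr (P u) v))).
have := Pp v; have := Pp u.
move: (pr (P u) u) (pr (P u) v) (pr (P v) v) => a b c a0 c0 q1 q2.
have [c_eq0|c_neq0] := eqVneq c 0.
  have [->|b0] := eqVneq b 0; first by rewrite expr0n mulr_ge0.
  exfalso; move: q2; rewrite c_eq0 mulr0 addr0 -mulr_natl [_ * b]mulrC.
  by have -> : 2 * (b * (- (a + 1) / (2 * b))) = - (a + 1) by [field]; lra.
have {}c0 : 0 < c by rewrite lt_neqAle eq_sym c_neq0.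
have : 0 <= (a * c - b ^+ 2) / c.
  by move: q1; congr (0 <= _); field.
by rewrite pmulr_lge0 ?invr_gt0// subr_ge0.
Qed.

(** Both t A + D and t A - D are positive; their Cauchy-Schwarz inequalities, with
    products p q and p' q', combine into one for D because
    2 sqrt (p q p' q') <= p q' + p' q. *)
Lemma form_sqr_le D A t : selfadjoint D -> selfadjoint A -> 0 <= t ->
  (forall h, `|pr (D h) h| <= t * pr (A h) h) ->
  forall u v, pr (D u) v ^+ 2 <= t ^+ 2 * (pr (A u) u * pr (A v) v).
Proof.
move=> Ds As t0 DA u v.
have N1 : (-1 : R) ^+ 2 = 1 by rewrite sqrrN expr1n.
have psdD c h : c ^+ 2 = 1 -> 0 <= t * pr (A h) h + c * pr (D h) h.
  move=> /eqP; rewrite sqrf_eq1 => cc; have := DA h.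
  by rewrite ler_norml => /andP[]; case/orP: cc => /eqP ->; lra.
have csD c : c ^+ 2 = 1 -> (t * pr (A u) v + c * pr (D u) v) ^+ 2 <=
    (t * pr (A u) u + c * pr (D u) u) * (t * pr (A v) v + c * pr (D v) v).
  move=> c1; have prD h p : pr ((t *: A + c *: D) h) p = t * pr (A h) p + c * pr (D h) p.
    by rewrite pr_opD !pr_opZ.
  rewrite -!prD; apply: cauchy_schwarz => [p q|h]; rewrite !prD ?psdD//.
  by rewrite (As p) (Ds p).
have := csD 1 (expr1n _ _); have := csD (-1) N1.
have := psdD 1 u (expr1n _ _); have := psdD 1 v (expr1n _ _).
have := psdD (-1) u N1; have := psdD (-1) v N1.
move: (pr (D u) u) (pr (D v) v) (pr (D u) v) => a b d.
move: (pr (A u) u) (pr (A v) v) (pr (A u) v) => a' b' d'.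
set p := t * a' + 1 * a; set q := t * b' + 1 * b; set x := t * d' + 1 * d.
set p' := t * a' + -1 * a; set q' := t * b' + -1 * b; set y := t * d' + -1 * d.
move=> q'0 p'0 q0 p0 yle xle.
have xy : - (x * y) *+ 2 <= p * q' + p' * q.
  clearbody p q x p' q' y.
  have pq0 : 0 <= p * q' + p' * q by rewrite addr_ge0 ?mulr_ge0.
  apply: (le_trans (ler_norm _)).
  rewrite -(ler_pXn2r (n := 2)) ?nnegrE// real_normK ?num_real//.
  have : x ^+ 2 * y ^+ 2 <= (p * q) * (p' * q') by rewrite ler_pM ?sqr_ge0.
  by have := sqr_ge0 (p * q' - p' * q); nra.
have -> : d = (x - y) / 2 by rewrite /x /y; field.
have -> : t ^+ 2 * (a' * b') = (p + p') * (q + q') / 4.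
  by rewrite /p /p' /q /q'; field.
by nra.
Qed.

(** A bound on a quadratic form carries over to the bilinear form without loss of
    constant. *)
Lemma form_abs_le D A t : selfadjoint D -> selfadjoint A -> psd A -> 0 <= t ->
  (forall h, `|pr (D h) h| <= t * pr (A h) h) ->
  forall u v, `|pr (D u) v| <= t * (Num.sqrt (pr (A u) u) * Num.sqrt (pr (A v) v)).
Proof.
move=> Ds As Ap t0 DA u v.
rewrite -(ler_pXn2r (n := 2)) ?nnegrE// ?mulr_ge0 ?sqrtr_ge0//.
rewrite real_normK ?num_real// !exprMn !sqr_sqrtr//.
exact: form_sqr_le.
Qed.

(** P minus its rank one part in the direction [u]: the symmetric rank one
    correction of the Broyden family, and also one step of a
    Cholesky decomposition. *)
Definition deflate P u := P - (pr (P u) u)^-1 *: (P \o uustar u \o P)%VF.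

Lemma deflateE P u h : selfadjoint P ->
  deflate P u h = P h - ((pr (P u) u)^-1 * pr (P u) h) *: P u.
Proof. by move=> Ps; rewrite /deflate opB opZ dyadE (Ps h u) scalerA. Qed.

Lemma selfadjoint_deflate P u : selfadjoint P -> selfadjoint (deflate P u).
Proof. by move=> Ps h v; rewrite !deflateE// !prE (Ps h v); ring. Qed.

Lemma psd_deflate P u : selfadjoint P -> psd P -> psd (deflate P u).
Proof.
move=> Ps Pp h; rewrite deflateE// !prE.
have [->|Pu] := eqVneq (pr (P u) u) 0; first by rewrite invr0 !mul0r subr0.
have Pu0 : 0 < pr (P u) u by rewrite lt_neqAle eq_sym Pu Pp.
have : pr (P u) h ^+ 2 / pr (P u) u <= pr (P h) h.
  by rewrite ler_pdivrMr// mulrC cauchy_schwarz.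
by lra.
Qed.

(** Deflating in a direction where P is nonzero enlarges the kernel, hence the
    decomposition by induction on the rank; the removed parts are squares of
    functionals. *)
Lemma psd_sum_squares P : selfadjoint P -> psd P ->
  exists r : seq 'Hom(E, R^o), forall h, P h = \sum_(a <- r) pr a h *: a.
Proof.
have [m] := ubnP (\dim {:E} - \dim (lker P)); elim: m P => // m IH P dimP Ps Pp.
have [[u Pu0]|P0] := pselect (exists u, pr (P u) u != 0); last first.
  exists [::] => h; rewrite big_nil; apply/lfunP => v.
  have := cauchy_schwarz Ps Pp h v.
  have -> : pr (P h) h = 0 by apply: contra_notP P0 => /eqP; exists h.
  rewrite mul0r => Phv.
  apply/eqP; rewrite -[X in X == _]/(pr (P h) v) -[X in _ == X]/(pr 0 v) pr0l.
  by rewrite -sqrf_eq0 eq_le Phv sqr_ge0.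
have Pu : pr (P u) u > 0 by rewrite lt_neqAle Pp andbT eq_sym.
have dimd : (\dim (lker P) < \dim (lker (deflate P u)))%N.
  rewrite (ltn_leqif (dimv_leqif_sup _)); last first.
    apply/subvP => h; rewrite !memv_ker deflateE// (Ps u h) => /eqP ->.
    by rewrite pr0l mulr0 scale0r subr0.
  apply/negP => /subvP /(_ u); rewrite !memv_ker deflateE// mulVf ?gt_eqF//.
  rewrite scale1r subrr eqxx => /(_ isT)/eqP Pu0'.
  by move: Pu; rewrite Pu0' pr0l ltxx.
have [|r rP] := IH (deflate P u) _ (selfadjoint_deflate u Ps) (psd_deflate u Ps Pp).
  by have := dimvS (subvf (lker (deflate P u))); lia.
(* the deflated part is the square of P u / sqrt <P u, u> *)
exists ((Num.sqrt (pr (P u) u))^-1 *: P u :: r) => h.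
rewrite big_cons -rP deflateE// prE scalerA mulrAC -invfM -expr2 sqr_sqrtr ?ltW//.
by rewrite addrC subrK.
Qed.

Lemma posdef_lker0 A : posdef A -> lker A == 0%VS.
Proof.
move=> Ap; rewrite -subv0; apply/subvP => h; rewrite memv_ker memv0 => /eqP Ah.
by apply: contraT => /(posdefP Ap); rewrite Ah pr0l ltxx.
Qed.

Lemma dim_dual : \dim {: 'Hom(E, R^o)} = \dim {:E}.
Proof. by rewrite !dimvf /dim /= muln1. Qed.

Lemma posdefK A : posdef A -> cancel A (A^-1)%VF.
Proof. by move=> /posdef_lker0/lker0_lfunK. Qed.

Lemma posdefVK A : posdef A -> cancel (A^-1)%VF A.
Proof.
move=> Ap s; apply: limg_lfunVK.
suff -> : limg A = fullv by rewrite memvf.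
apply/eqP; rewrite eqEdim subvf.
rewrite (limg_dim_eq (f := A)); last by rewrite (eqP (posdef_lker0 Ap)) capv0.
by have := dim_dual => ->; rewrite leqnn.
Qed.

Lemma inv_selfadjoint A s a : selfadjoint A -> posdef A ->
  pr s ((A^-1)%VF a) = pr a ((A^-1)%VF s).
Proof. by move=> As Ap; rewrite -{1}(posdefVK Ap s) As posdefVK. Qed.

Lemma inv_ge0 A s : posdef A -> 0 <= pr s ((A^-1)%VF s).
Proof. by move=> Ap; rewrite -{1}(posdefVK Ap s) posdef_psd. Qed.

(** With p = G^-1 s and q = A^-1 s, the Cauchy-Schwarz inequality for A gives
    <s, p>^2 = <A q, p>^2 <= <s, q> <A p, p> <= c <s, q> <s, p>. *)
Lemma inv_antitone A G c s : selfadjoint A -> posdef A -> posdef G -> 0 <= c ->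
  loewner_le A (c *: G) -> pr s ((G^-1)%VF s) <= c * pr s ((A^-1)%VF s).
Proof.
move=> As Ap Gp c0 /loewnerP AG; set p := (G^-1)%VF s; set q := (A^-1)%VF s.
have := cauchy_schwarz As (posdef_psd Ap) q p.
have := AG p; rewrite opZ prZl posdefVK// /q posdefVK// -/p -/q => Ap_le.
have q0 : 0 <= pr s q by apply: inv_ge0.
have [->|sp] := eqVneq (pr s p) 0; first by rewrite mulr_ge0.
have {sp} : 0 < pr s p by rewrite lt_neqAle eq_sym sp inv_ge0.
move: Ap_le q0; move: (pr s p) (pr s q) (pr (A p) p) => sp sq Ap' Apl q0 sp0 le1.
have : sp * sp <= (c * sq) * sp by rewrite -expr2 (le_trans le1)//; nra.
by rewrite ler_pM2r.
Qed.

(** The trace of the endomorphism A^-1 P of [E]. *)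
Definition rel_trace A P : R :=
  \sum_(i < \dim {:E}) coord (vbasis {:E}) i ((A^-1)%VF (P (vbasis {:E})`_i)).

Lemma rel_traceD A P G : rel_trace A (P + G) = rel_trace A P + rel_trace A G.
Proof.
by rewrite /rel_trace -big_split; apply: eq_bigr => i _; rewrite opD !linearD.
Qed.
Lemma rel_traceZ A c P : rel_trace A (c *: P) = c * rel_trace A P.
Proof.
by rewrite /rel_trace mulr_sumr; apply: eq_bigr => i _; rewrite opZ !linearZ.
Qed.
Lemma rel_traceB A P G : rel_trace A (P - G) = rel_trace A P - rel_trace A G.
Proof. by rewrite rel_traceD -[- G]scaleN1r rel_traceZ mulN1r. Qed.

(** The trace of the rank one endomorphism h |-> <s, h> w. *)
Lemma sum_coord s w :
  \sum_(i < \dim {:E}) coord (vbasis {:E}) i (pr s (vbasis {:E})`_i *: w) = pr s w.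
Proof.
rewrite [in RHS](coord_vbasis (memvf w)) pr_sumr; apply: eq_bigr => i _.
by rewrite linearZ prZr /= mulrC.
Qed.

(** The traces of the rank one corrections in the Broyden update. *)
Lemma rel_trace_dyad A P G u : selfadjoint G ->
  rel_trace A (P \o uustar u \o G)%VF = pr (G u) ((A^-1)%VF (P u)).
Proof.
move=> Gs; rewrite -sum_coord; apply: eq_bigr => i _.
by rewrite dyadE (Gs _ u) linearZ.
Qed.

(** This expression is manifestly nonnegative and monotone in A^-1, which is how
    the inequalities on traces below are obtained. *)
Lemma rel_trace_sum_squares A P (r : seq 'Hom(E, R^o)) :
  (forall h, P h = \sum_(a <- r) pr a h *: a) ->
  rel_trace A P = \sum_(a <- r) pr a ((A^-1)%VF a).
Proof.
move=> rP; rewrite /rel_trace.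
under eq_bigr => i _ do rewrite rP !linear_sum.
rewrite exchange_big; apply: eq_bigr => a _; rewrite -sum_coord.
by apply: eq_bigr => i _; rewrite linearZ.
Qed.

Lemma rel_trace_self A : posdef A -> rel_trace A A = (\dim {:E})%:R.
Proof.
move=> Ap; rewrite /rel_trace (eq_bigr (fun=> 1)) ?sumr_const ?card_ord// => i _.
by rewrite posdefK// coord_free ?eqxx// (basis_free (vbasisP _)).
Qed.

Lemma rel_trace_ge0 A P : posdef A -> selfadjoint P -> psd P -> 0 <= rel_trace A P.
Proof.
move=> Ap Ps /(psd_sum_squares Ps)[r rP].
by rewrite (rel_trace_sum_squares _ rP) sumr_ge0// => a _; exact: inv_ge0.
Qed.

Lemma rel_trace_antitone A G P c : selfadjoint A -> posdef A -> posdef G -> 0 <= c ->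
  loewner_le A (c *: G) -> selfadjoint P -> psd P ->
  rel_trace G P <= c * rel_trace A P.
Proof.
move=> As Ap Gp c0 AG Ps /(psd_sum_squares Ps)[r rP].
rewrite !(rel_trace_sum_squares _ rP) mulr_sumr ler_sum// => a _.
exact: inv_antitone.
Qed.

(** For P = sum a a^*, each <a, h>^2 is at most <a, A^-1 a> <A h, h> by
    Cauchy-Schwarz. *)
Lemma le_rel_trace A P : selfadjoint A -> posdef A -> selfadjoint P -> psd P ->
  loewner_le P (rel_trace A P *: A).
Proof.
move=> As Ap Ps /(psd_sum_squares Ps)[r rP]; apply/loewnerP => h.
rewrite opZ prZl (rel_trace_sum_squares _ rP) rP pr_suml mulr_suml ler_sum// => a _.
rewrite prZl -expr2.
by have := cauchy_schwarz As (posdef_psd Ap) ((A^-1)%VF a) h; rewrite !posdefVK.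
Qed.

Section Broyden.
Variables (tau : R) (G A : 'Hom(E, 'Hom(E, R^o))) (u : E).
Hypotheses (As : selfadjoint A) (Ap : posdef A) (Gs : selfadjoint G).
Hypotheses (AG : loewner_le A G) (tau01 : 0 <= tau <= 1) (u0 : u != 0).

Let P := G - A.

Let dfp : 'Hom(E, 'Hom(E, R^o)) :=
  G - (pr (A u) u)^-1 *: ((A \o uustar u \o G) + (G \o uustar u \o A))%VF +
  ((pr (G u) u / pr (A u) u + 1) / pr (A u) u) *: (A \o uustar u \o A)%VF.

Let Au : 0 < pr (A u) u. Proof. exact: posdefP. Qed.
Let prP h v : pr (P h) v = pr (G h) v - pr (A h) v.
Proof. by rewrite opB prBl. Qed.
Let Ps : selfadjoint P. Proof. exact: selfadjointB. Qed.
Let Pp : psd P.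
Proof. by move: AG => /loewnerP H h; rewrite prP subr_ge0. Qed.

Lemma dfp_form h v : pr (dfp h) v = pr (G h) v
  - (pr (G u) h * pr (A u) v + pr (A u) h * pr (G u) v) / pr (A u) u
  + (pr (G u) u / pr (A u) u + 1) / pr (A u) u * (pr (A u) h * pr (A u) v).
Proof.
rewrite /dfp opD opB !opZ opD !dyadE (Gs h u) (As h u).
by rewrite prDl prBl !prZl prDl !prZl; ring.
Qed.

Lemma Broyd_form h v : G u != A u -> pr (Broyd tau G A u h) v =
  tau * pr (dfp h) v + (1 - tau) * (pr (A h) v + pr (deflate P u h) v).
Proof.
move=> GA; rewrite /Broyd (negPf GA).
rewrite pr_opD !pr_opZ; congr (_ + _ * _). rewrite /deflate pr_opB [in RHS]pr_opB prP.
by rewrite addrA [pr (A h) v + _]addrC subrK.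
Qed.

Let proj h := h - (pr (A u) h / pr (A u) u) *: u.

(** [proj h] is the component of [h] that is A-orthogonal to [u]. *)
Lemma form_proj Q h : selfadjoint Q -> pr (Q (proj h)) (proj h) =
  pr (Q h) h - 2 * (pr (A u) h / pr (A u) u) * pr (Q u) h
  + (pr (A u) h / pr (A u) u) ^+ 2 * pr (Q u) u.
Proof.
move=> Qs; rewrite /proj; move: (pr (A u) h / _) => c.
rewrite linearB linearZ. rewrite prBl !prBr. rewrite !prZl !prZr (Qs h u). ring.
Qed.

(** The first (DFP) part of the update uses G on the A-orthogonal complement of
    [u] and A along [u].  Compared with [form_square], this shows that it lies
    between A and eta A. *)
Lemma dfp_square h :
  pr (dfp h) h = pr (G (proj h)) (proj h) + pr (A u) h ^+ 2 / pr (A u) u.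
Proof. by rewrite dfp_form form_proj//; field; rewrite gt_eqF. Qed.

Lemma form_square h :
  pr (A h) h = pr (A (proj h)) (proj h) + pr (A u) h ^+ 2 / pr (A u) u.
Proof. by rewrite form_proj//; field; rewrite gt_eqF. Qed.

Lemma selfadjoint_Broyd : selfadjoint (Broyd tau G A u).
Proof.
case: (eqVneq (G u) (A u)) => [e|GA]; first by rewrite /Broyd e eqxx.
move=> h v; rewrite !Broyd_form// !dfp_form (selfadjoint_deflate _ Ps h v).
by rewrite (As h v) (Gs h v); ring.
Qed.

Lemma Broyd_ge : loewner_le A (Broyd tau G A u).
Proof.
case: (eqVneq (G u) (A u)) => [e|GA]; first by rewrite /Broyd e eqxx.
apply/loewnerP => h; rewrite Broyd_form//.
have : pr (A h) h <= pr (dfp h) h.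
  by rewrite dfp_square (form_square h) lerD2r; move/loewnerP: AG.
have := psd_deflate u Ps Pp h; move: tau01.
move: (pr (dfp h) h) (pr (deflate P u h) h) (pr (A h) h) => x y z.
by move=> /andP[]; nra.
Qed.

Lemma Broyd_le eta : 1 <= eta -> loewner_le G (eta *: A) ->
  loewner_le (Broyd tau G A u) (eta *: A).
Proof.
move=> eta1 GA'; case: (eqVneq (G u) (A u)) => [e|GA]; first by rewrite /Broyd e eqxx.
have {}GA' h : pr (G h) h <= eta * pr (A h) h.
  by move/loewnerP: GA' => /(_ h); rewrite opZ prZl.
apply/loewnerP => h; rewrite Broyd_form// opZ prZl.
have : pr (dfp h) h <= eta * pr (A h) h.
  rewrite dfp_square (form_square h) mulrDr; apply: lerD => //.
  by rewrite ler_peMl// divr_ge0 ?sqr_ge0// ltW.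
have : pr (deflate P u h) h <= pr (G h) h - pr (A h) h.
  rewrite deflateE// prBl prZl prP lerBlDr lerDl -mulrA -expr2.
  by rewrite mulr_ge0 ?invr_ge0 ?sqr_ge0// Pp.
have := GA' h; move: tau01.
move: (pr (dfp h) h) (pr (deflate P u h) h) (pr (A h) h) (pr (G h) h) => x y z w.
by move=> /andP[]; nra.
Qed.

(** The DFP part lowers the trace by exactly this amount.  The rank one
    part lowers it by <P u, A^-1 P u> / <P u, u>, which is at least as much by
    Cauchy-Schwarz. *)
Lemma rel_trace_Broyd_le :
  rel_trace A (Broyd tau G A u) <= rel_trace A G - pr (P u) u / pr (A u) u.
Proof.
case: (eqVneq (G u) (A u)) => [e|GA].
  by rewrite /Broyd e eqxx prP e subrr mul0r subr0.
have -> : Broyd tau G A u = tau *: dfp +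
    (1 - tau) *: (G - (pr (P u) u)^-1 *: (P \o uustar u \o P)%VF).
  by rewrite /Broyd (negPf GA).
rewrite rel_traceD !rel_traceZ.
have -> : rel_trace A dfp = rel_trace A G - pr (P u) u / pr (A u) u.
  rewrite /dfp rel_traceD rel_traceB !rel_traceZ rel_traceD !rel_trace_dyad//.
  rewrite (inv_selfadjoint (A u) (G u))// !posdefK// prP.
  by field; rewrite gt_eqF.
rewrite rel_traceB rel_traceZ rel_trace_dyad//.
set w := (A^-1)%VF (P u).
suff : pr (P u) u / pr (A u) u <= (pr (P u) u)^-1 * pr (P u) w.
  move: tau01 => /andP[]; move: (rel_trace A G) (pr _ _ / _) (_^-1 * pr _ _) => T q z.
  by nra.
have [->|Pu] := eqVneq (pr (P u) u) 0; first by rewrite invr0 !mul0r.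
have {Pu} Pu : 0 < pr (P u) u by rewrite lt_neqAle eq_sym Pu Pp.
rewrite ler_pdivrMr// -mulrA [X in _ <= X]mulrC ler_pdivlMr// -expr2.
have := cauchy_schwarz As (posdef_psd Ap) w u.
by rewrite /w posdefVK.
Qed.

End Broyden.
End Operators.

(** * Gradient and Hessian along lines *)
Section Calc.
Context (R : realType).

Lemma functional_bounded (V : vectType R) (s : 'Hom(V, R^o)) :
  exists2 C, 0 <= C & forall x : V, `|pr s x| <= C * coord_norm x.
Proof.
exists (\sum_(i < \dim {:V}) `|pr s (vbasis {:V})`_i|); first by rewrite sumr_ge0.
move=> x; rewrite {1}(coord_vbasis (memvf x)) pr_sumr.
apply: le_trans (ler_norm_sum _ _ _) _.
rewrite mulr_suml ler_sum// => i _; rewrite prZr normrM mulrC ler_wpM2l//.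
rewrite /coord_norm (bigD1 i)//= lerDl sumr_ge0//.
Qed.

(** Continuity for the topology of [normed V], which differential calculus
    needs of the functionals that are applied to the gradient. *)
Lemma functional_continuous (V : vectType R) (s : 'Hom(V, R^o)) :
  continuous (s : normed V -> R^o).
Proof.
apply: (@bounded_linear_continuous R (normed V) R^o s).
have [C C0 sC] := functional_bounded s.
apply/linear_boundedP; near=> r => x; apply: (le_trans (sC x)).
by apply: ler_wpM2r => //; exact: (normr_ge0 (x : normed V)).
Unshelve. all: by end_near. Qed.

Variable E : vectType R.
Implicit Types (x y h u v w p : E).

(** Evaluation at a point, as a functional on the dual space: it reduces
    the study of the gradient to real-valued functions. *)
Definition eval_fun h (s : 'Hom(E, R^o)) : R^o := s h.
Fact eval_fun_is_linear h : linear (eval_fun h).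
Proof. by move=> a s t; rewrite /eval_fun !lfunE /= lfunE. Qed.
HB.instance Definition _ h := GRing.isLinear.Build R 'Hom(E, R^o) R^o _
  (eval_fun h) (eval_fun_is_linear h).
Definition eval h : 'Hom('Hom(E, R^o), R^o) := linfun (eval_fun h).
Lemma pr_eval h (s : 'Hom(E, R^o)) : pr (eval h) s = pr s h.
Proof. exact: lfunE. Qed.

Lemma is_derive_line (W : normedModType R) (F : normed E -> W)
    (l : {linear W -> R^o}) (p v : normed E) (t : R) :
  continuous l -> differentiable F (p + t *: v) ->
  is_derive t 1 (fun r : R => l (F (p + r *: v))) (l ('d F (p + t *: v) v)).
Proof.
move=> lc dF; set g := fun r : R => p + r *: v.
have gd : is_diff t g (fun r : R => r *: v).
  have -> : g = cst p + ( *:%R ^~ v) by apply/funext.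
  by apply: is_diff_eq; rewrite add0r.
have ld : is_diff (F (g t)) l l.
  by apply: DiffDef; [exact: linear_differentiable | exact: diff_lin].
have Fd : is_diff (g t) F ('d F (g t)) by exact: differentiableP.
have [Hd Hv] : is_diff t (l \o (F \o g)) (l \o ('d F (g t) \o (fun r : R => r *: v))).
  by typeclasses eauto.
apply: DeriveDef; first exact/derivable1_diffP.
by rewrite deriveE// Hv /= scale1r.
Qed.

Lemma differentiable_expansion (W : vectType R) (F : E -> W)
    (l : 'Hom(W, R^o)) p (eps : R) :
  differentiable (F : normed E -> normed W) (p : normed E) -> 0 < eps ->
  exists2 d, 0 < d & forall v, coord_norm v < d ->
   `|pr l (F (p + v)) - pr l (F p)
       - pr l ('d (F : normed E -> normed W) (p : normed E) v)| <= eps * coord_norm v.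
Proof.
move=> dF eps0; have [C C0 lC] := functional_bounded l.
have [_ /eqaddoP H] := (diff_locallyP (p : normed E) (F : normed E -> normed W)).1 dF.
have eC : 0 < eps / (C + 1) by rewrite divr_gt0// ltr_wpDl.
have /nbhs_norm0P[d /= d0 Hd] := H _ eC.
exists d => // v vd.
have := Hd v vd => /= Hv.
rewrite -!prBr (le_trans (lC _))//.
have -> : F (p + v) = F (v + p) by rewrite addrC.
rewrite -addrA -opprD.
apply: (le_trans (ler_wpM2l C0 Hv)).
have -> : `|v : normed E| = coord_norm v by [].
rewrite mulrA ler_wpM2r//; first exact: (normr_ge0 (v : normed E)).
rewrite mulrCA ler_piMr ?ltW//.
by rewrite ltr_pdivrMr ?ltr_wpDl// mul1r ltrDl.
Qed.

Lemma MVT01 (g dg : R -> R) : (forall t : R, is_derive t 1 g (dg t)) ->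
  exists2 c, 0 < c < 1 & g 1 - g 0 = dg c.
Proof.
move=> gd; have [|c] := MVT (ltr01 : (0 : R) < 1) (fun (c : R) _ => gd c).
  apply: derivable_within_continuous => c _.
  by have [] := gd c.
by rewrite subr0 mulr1 in_itv /= => c01 ->; exists c.
Qed.

Section Hessian.
Variable f : E -> R.
Hypothesis f2 : twice_differentiable f.

Lemma is_derive_f_line p v (t : R) :
  is_derive t 1 (fun r : R => f (p + r *: v) : R) (pr (gradient f (p + t *: v)) v).
Proof.
have idc : continuous (idfun : R^o -> R^o) by move=> z; exact: cvg_id.
have := @is_derive_line R^o (f : normed E -> R^o) (@idfun R^o) p v t idc (f2.1 _).
by rewrite /= -gradientE.
Qed.

Lemma is_derive_gradient_line p v h (t : R) :
  is_derive t 1 (fun r : R => pr (gradient f (p + r *: v)) h)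
    (pr (hessian f (p + t *: v) v) h).
Proof.
have := @is_derive_line (normed 'Hom(E, R^o))
  (gradient f : normed E -> normed 'Hom(E, R^o))
  (eval h : {linear normed 'Hom(E, R^o) -> R^o}) p v t
  (@functional_continuous _ (eval h)) (f2.2 _).
rewrite -hessianE.
have -> : (fun r : R => eval h (gradient f ((p : normed E) + r *: (v : normed E)))) =
  (fun r : R => pr (gradient f (p + r *: v)) h).
  by apply/funext => r; rewrite -pr_eval.
by rewrite -[X in is_derive _ _ _ X]/(pr (eval h) (hessian f (p + t *: v) v)) pr_eval.
Qed.

Let coordn (v : E) := coord_norm v.

(** The mean value theorem turns the second difference of f into a first difference
    of the gradient, which the differentiability of the gradient at the single
    point [p] controls, wherever the intermediate point lies. *)
Lemma second_difference p h k (eps : R) : 0 < eps ->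
  exists2 d, 0 < d & forall t, 0 < t -> t < d ->
  `|f (p + t *: k + t *: h) - f (p + t *: h) - f (p + t *: k) + f p
     - t ^+ 2 * pr (hessian f p k) h|
  <= eps * t ^+ 2 * (2 * (coordn h + coordn k)).
Proof.
move=> eps0; have [d d0 dP] := differentiable_expansion (eval h) (f2.2 p) eps0.
have cn0 v : 0 <= coordn v by exact: (normr_ge0 (v : normed E)).
have cnZ (t : R) v : 0 <= t -> coordn (t *: v) = t * coordn v.
  by move=> t0; rewrite /coordn coord_normZ ger0_norm.
set N := coordn h + coordn k.
have N0 : 0 <= N by rewrite addr_ge0.
(* both points used below lie within t N of p; the 1 avoids a division by 0 *)
exists (d / (N + 1)); first by rewrite divr_gt0// ltr_wpDl.
move=> t t0; rewrite ltr_pdivlMr ?ltr_wpDl// => td.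
pose g (r : R) : R := f (p + t *: k + r *: (t *: h)) - f (p + r *: (t *: h)).
have [|c /andP[c0 c1]] := @MVT01 g (fun r =>
   pr (gradient f (p + t *: k + r *: (t *: h))) (t *: h)
   - pr (gradient f (p + r *: (t *: h))) (t *: h)).
  by move=> r; apply: is_deriveB; exact: is_derive_f_line.
rewrite /g !scale1r !scale0r !addr0 opprB => gE.
have -> : f (p + t *: k + t *: h) - f (p + t *: h) - f (p + t *: k) + f p =
   f (p + t *: k + t *: h) - f (p + t *: h) + (f p - f (p + t *: k)) by ring.
rewrite gE !prZr.
pose v1 := t *: k + c *: (t *: h); pose v2 := c *: (t *: h).
have v2E : coordn v2 = t * (c * coordn h).
  by rewrite /v2 (cnZ c) ?ltW// (cnZ t) ?ltW// mulrCA.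
have ch : c * coordn h <= coordn h by rewrite ler_piMl ?cn0 ?(ltW c1).
have v2le : coordn v2 <= t * N.
  by rewrite v2E ler_pM2l// /N; have := cn0 k; lra.
have v1le : coordn v1 <= t * N.
  apply: (le_trans (coord_normD _ _)).
  rewrite -!/(coordn _) -/v2 v2E (cnZ t) ?(ltW t0)//.
  by rewrite -mulrDr ler_pM2l// /N; lra.
have vd v : coordn v <= t * N -> coordn v < d by move=> vle; lra.
have Hv1 : pr (hessian f p v1) h = t * pr (hessian f p k) h + pr (hessian f p v2) h.
  by rewrite /v1 linearD prDl linearZ prZl.
have := dP v1 (vd _ v1le); have := dP v2 (vd _ v2le).
rewrite -!hessianE !pr_eval Hv1 -!/(coordn _) => e2 e1.
rewrite -[p + t *: k + _]addrA -/v1 -/v2.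
have en1 : eps * coordn v1 <= eps * (t * N) by rewrite ler_pM2l.
have en2 : eps * coordn v2 <= eps * (t * N) by rewrite ler_pM2l.
set X1 := pr (gradient f (p + v1)) h in e1 *.
set X2 := pr (gradient f (p + v2)) h in e2 *.
move: (pr (gradient f p) h) (pr (hessian f p k) h) (pr (hessian f p v2) h) e1 e2.
move=> X0 H H2 e1 e2; clearbody X1 X2.
have -> : t * X1 - t * X2 - t ^+ 2 * H = t * (X1 - X2 - t * H) by ring.
rewrite normrM (gtr0_norm t0).
have -> : eps * t ^+ 2 * (2 * N) = t * (2 * (eps * (t * N))) by ring.
rewrite ler_pM2l//; move: e1 e2 en1 en2; rewrite !ler_norml.
clear -R; move: (eps * (t * N)) (eps * coordn v1) (eps * coordn v2) (t * H).
move=> a1 a2 a3 a4.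
by move=> /andP[? ?] /andP[? ?] ? ?; apply/andP; split; lra.
Qed.

(** The second difference is symmetric in its two directions. *)
Lemma selfadjoint_hessian p : selfadjoint (hessian f p).
Proof.
move=> k h; apply/eqP; rewrite -subr_eq0 -normr_le0; apply/ler_addgt0Pl => e e0.
have cn0 v : 0 <= coordn v by exact: (normr_ge0 (v : normed E)).
set N := 2 * (coordn h + coordn k).
have N0 : 0 <= N by rewrite mulr_ge0// addr_ge0.
have e0' : 0 < e / (2 * (N + 1)) by rewrite divr_gt0// mulr_gt0// ltr_wpDl.
have [d1 d10 D1] := second_difference p h k e0'.
have [d2 d20 D2] := second_difference p k h e0'.
pose t := Num.min d1 d2 / 2.
have m0 : 0 < Num.min d1 d2 by rewrite lt_min d10.
have t0 : 0 < t by rewrite divr_gt0.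
have tm : t < Num.min d1 d2 by rewrite /t; lra.
move: tm; rewrite lt_min => /andP[t1 t2].
have := D1 t t0 t1; have := D2 t t0 t2.
rewrite [coordn k + _]addrC -/N addrAC [p + t *: k + t *: h]addrAC.
set F := f (p + t *: h + t *: k); set a := f _; set b := f _; set c := f p.
set H1 := pr _ k; set H2 := pr _ h; set K := _ * t ^+ 2 * N.
move=> i1 i2; rewrite addr0.
have t20 : 0 < t ^+ 2 by rewrite exprn_gt0.
rewrite -(ler_pM2l t20).
have -> : t ^+ 2 * `|H2 - H1| = `|t ^+ 2 * H2 - t ^+ 2 * H1|.
  by rewrite -mulrBr normrM (gtr0_norm t20).
have KE : 2 * K <= t ^+ 2 * e.
  have -> : 2 * K = t ^+ 2 * (e * (N / (N + 1))) by rewrite /K; field; lra.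
  by rewrite ler_pM2l// ler_piMr ?(ltW e0)// ler_pdivrMr ?ltr_wpDl// mul1r lerDl.
move: i1 i2; rewrite !ler_norml.
by move=> /andP[? ?] /andP[? ?]; apply/andP; split; lra.
Qed.

Variable M : R.
Hypotheses (M0 : 0 <= M) (sc : strongly_self_concordant M f).
Hypothesis (fpos : forall y : E, posdef (hessian f y)).

Lemma local_normE p v : local_norm f p v = Num.sqrt (pr (hessian f p v) v).
Proof. by []. Qed.

Lemma local_norm_sqr p v : local_norm f p v ^+ 2 = pr (hessian f p v) v.
Proof. by rewrite sqr_sqrtr// posdef_psd. Qed.

Lemma local_normZ p (c : R) v : local_norm f p (c *: v) = `|c| * local_norm f p v.
Proof.
rewrite !local_normE linearZ prZl prZr mulrA -expr2 sqrtrM ?sqr_ge0//.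
by rewrite sqrtr_sqr.
Qed.

Lemma hessian_diff_le p q z w h : pr (hessian f q h) h - pr (hessian f p h) h <=
  M * local_norm f z (q - p) * pr (hessian f w h) h.
Proof. by have /loewnerP/(_ h) := sc p q z w; rewrite pr_opB pr_opZ. Qed.

(** Along the segment, t |-> <f'(p + t v), h> has derivative <f''(p + t v) v, h>,
    which by strong self-concordance differs from <f''(p) v, h> by at most
    t M |v| (|v| |h|); integrating t over [0, 1] gives the factor 1 / 2. *)
Lemma gradient_error_le p v h :
  pr (gradient f (p + v)) h - pr (gradient f p) h - pr (hessian f p v) h <=
  M * local_norm f p v / 2 * (local_norm f p v * local_norm f p h).
Proof.
set r := local_norm f p v; set c := pr (hessian f p v) h.
set K := r * local_norm f p h.
have r0 : 0 <= r by apply: sqrtr_ge0.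
(* g is nonincreasing; the quadratic term integrates the bound t M r K *)
pose g (t : R) : R :=
  pr (gradient f (p + t *: v)) h - (t * c + t ^+ 2 * (M * r / 2 * K)).
have [|t /andP[t0 t1]] := @MVT01 g
  (fun t : R => pr (hessian f (p + t *: v) v) h - (c + t * (M * r * K))).
  move=> t; apply: is_deriveB; first exact: is_derive_gradient_line.
  by apply: is_derive_eq; rewrite /GRing.scale/=; field.
rewrite /g !scale1r !scale0r !addr0.
suff : pr (hessian f (p + t *: v) v) h - c <= t * (M * r * K).
  move: (pr (gradient f (p + v)) h) (pr (gradient f p) h) => a b.
  by clear; move: c (pr _ h) K => c d K; lra.
rewrite /c -pr_opB; apply: le_trans (ler_norm _) _.
rewrite mulrA /K {2}/r !local_normE. apply: form_abs_le.
- by apply: selfadjointB; exact: selfadjoint_hessian.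
- exact: selfadjoint_hessian.
- exact: posdef_psd.
- by rewrite !mulr_ge0// ltW.
move=> k; rewrite pr_opB ler_norml.
have ln s : `|s| = t -> M * local_norm f p (s *: v) = t * (M * r).
  by move=> st; rewrite local_normZ st mulrCA.
have := hessian_diff_le p (p + t *: v) p p k.
have -> : p + t *: v - p = t *: v by rewrite addrC addKr.
have := hessian_diff_le (p + t *: v) p p p k.
have -> : p - (p + t *: v) = - t *: v by rewrite opprD addNKr scaleNr.
rewrite !ln ?normrN ?gtr0_norm// => lower upper.
by apply/andP; split=> //; rewrite lerNl opprB.
Qed.

Lemma gradient_error p v h :
  `|pr (gradient f (p + v)) h - pr (gradient f p) h - pr (hessian f p v) h| <=
  M * local_norm f p v / 2 * (local_norm f p v * local_norm f p h).
Proof.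
rewrite ler_norml gradient_error_le andbT lerNl !opprD.
have := gradient_error_le p v (- h).
by rewrite !prNr -[- h]scaleN1r local_normZ normrN1 mul1r.
Qed.

Lemma hessian_step p v : let r := local_norm f p v in
  loewner_le (hessian f p) ((1 + M * r) *: hessian f (p + v)) /\
  loewner_le (hessian f (p + v)) ((1 + M * r) *: hessian f p).
Proof.
move=> r; split; apply/loewnerP => h; rewrite pr_opZ mulrDl mul1r -lerBlDl.
  have := hessian_diff_le (p + v) p p (p + v) h.
  have -> : p - (p + v) = (-1) *: v by rewrite scaleN1r opprD addNKr.
  by rewrite local_normZ normrN1 mul1r.
have := hessian_diff_le p (p + v) p p h.
by have -> : p + v - p = v by rewrite addrC addKr.
Qed.

End Hessian.
End Calc.

(** * The operator B and the greedy choice *)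

Section Basis.
Context (R : realType) (E : vectType R) (n : nat) (e : n.-tuple E).
Hypothesis he : basis_of {:E} e.
Implicit Types (A G P : 'Hom(E, 'Hom(E, R^o))) (s : 'Hom(E, R^o)).

Let S : 'Hom('Hom(E, R^o), E) := \sum_(i < n) uustar (tnth e i).

Let SE s : S s = \sum_(i < n) pr s (tnth e i) *: tnth e i.
Proof. by rewrite /S sum_lfunE; apply: eq_bigr => i _; rewrite uustarE. Qed.

Let S_coord s c : S s = \sum_(i < n) c i *: tnth e i -> forall i, pr s (tnth e i) = c i.
Proof.
move=> Sc i; have fe : free e := basis_free he.
have H : \sum_(i < n) (pr s (tnth e i) - c i) *: e`_i = 0.
  transitivity (S s - S s); last by rewrite subrr.
  rewrite {2}Sc SE -sumrB; apply: eq_bigr => j _.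
  by rewrite scalerBl (tnth_nth 0).
by have /freeP/(_ _ H i)/eqP := fe; rewrite subr_eq0 => /eqP.
Qed.

Let span_e w : exists c, w = \sum_(i < n) c i *: tnth e i.
Proof.
exists (fun i => coord e i w); rewrite {1}(coord_span (X := e) (v := w)).
  by apply: eq_bigr => i _; rewrite (tnth_nth 0).
by rewrite (span_basis he) memvf.
Qed.

Let S_ker0 : lker S == 0%VS.
Proof.
apply/lker0P => s s' ss'; apply/lfunP => w; have [c ->] := span_e w.
rewrite -[LHS]/(pr s _) -[RHS]/(pr s' _) !pr_sumr; apply: eq_bigr => i _.
by rewrite !prZr (S_coord (c := fun i => pr s' (tnth e i)))// ss' SE.
Qed.

Let S_surj w : exists s, S s = w.
Proof.
suff /memv_imgP[s _ ->] : w \in limg S by exists s.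
suff -> : limg S = fullv by rewrite memvf.
apply/eqP; rewrite eqEdim subvf.
rewrite (limg_dim_eq (f := S)); last by rewrite (eqP S_ker0) capv0.
by rewrite -(dim_dual E) leqnn.
Qed.

Lemma basis_operatorK s : basis_operator e (S s) = s.
Proof. exact: lker0_lfunK. Qed.

Lemma basis_operator_selfadjoint : selfadjoint (basis_operator e).
Proof.
move=> u v; have [s <-] := S_surj u; have [t <-] := S_surj v.
rewrite !basis_operatorK !SE !pr_sumr; apply: eq_bigr => i _.
by rewrite !prZr mulrC.
Qed.

Lemma basis_operator_posdef : posdef (basis_operator e).
Proof.
move=> u; have [s <-] := S_surj u => Ss0.
rewrite -[X in _ < X]/(pr _ _) basis_operatorK SE pr_sumr.
rewrite lt_neqAle sumr_ge0 ?andbT; last by move=> i _; rewrite prZr -expr2 sqr_ge0.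
apply: contra Ss0; rewrite eq_sym psumr_eq0; last first.
  by move=> i _; rewrite prZr -expr2 sqr_ge0.
move=> /allP s0; rewrite SE big1// => i _.
have := s0 i (mem_index_enum _); rewrite prZr mulf_eq0 orbb => /eqP ->.
by rewrite scale0r.
Qed.

Lemma basis_operator_unit i : pr (basis_operator e (tnth e i)) (tnth e i) = 1.
Proof.
have [s Ss] := S_surj (tnth e i).
rewrite -{1}Ss basis_operatorK (S_coord (c := fun j => (j == i)%:R)) ?eqxx// Ss.
by rewrite (bigD1 i)//= eqxx scale1r big1 ?addr0// => j /negPf ->; rewrite scale0r.
Qed.

(** The inverse of B is sum e_i e_i^*. *)
Lemma rel_trace_basis_operator P : selfadjoint P -> psd P ->
  rel_trace (basis_operator e) P = \sum_(i < n) pr (P (tnth e i)) (tnth e i).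
Proof.
move=> Ps /(psd_sum_squares Ps)[r rP]; rewrite (rel_trace_sum_squares _ rP).
under [RHS]eq_bigr => i _ do rewrite rP pr_suml.
rewrite exchange_big; apply: eq_bigr => a _.
have -> : ((basis_operator e)^-1)%VF a = S a.
  by rewrite -{1}(basis_operatorK a) posdefK//; exact: basis_operator_posdef.
by rewrite SE pr_sumr; apply: eq_bigr => i _; rewrite prZr prZl.
Qed.

(** Summing <P e_i, e_i> <= rho <A e_i, e_i> <= rho L over the basis bounds the
    trace relative to B by n L rho, and mu B <= A costs a factor 1 / mu. *)
Lemma rel_trace_le_max_ratio A P (mu L rho : R) : 0 < mu -> 0 < L ->
  selfadjoint A -> posdef A -> selfadjoint P -> psd P ->
  loewner_le (mu *: basis_operator e) A -> loewner_le A (L *: basis_operator e) ->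
  (forall i, pr (P (tnth e i)) (tnth e i) <= rho * pr (A (tnth e i)) (tnth e i)) ->
  0 <= rho -> rel_trace A P <= n%:R * L / mu * rho.
Proof.
move=> mu0 L0 As Ap Ps Pp /loewnerP muA /loewnerP AL le_rho rho0.
have muV0 : 0 <= mu^-1 by rewrite invr_ge0 ltW.
have : rel_trace A P <= mu^-1 * rel_trace (basis_operator e) P.
  apply: rel_trace_antitone => //.
  - exact: basis_operator_selfadjoint.
  - exact: basis_operator_posdef.
  apply/loewnerP => h; rewrite pr_opZ mulrC ler_pdivlMr// mulrC -pr_opZ.
  exact: muA.
move=> /le_trans -> //.
have -> : n%:R * L / mu * rho = mu^-1 * (n%:R * (L * rho)) by ring.
rewrite rel_trace_basis_operator// ler_pM2l ?invr_gt0// mulr_natl.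
rewrite -[n in _ *+ n]card_ord -sumr_const ler_sum// => i _.
apply: (le_trans (le_rho i)); rewrite mulrC ler_wpM2r//.
by have := AL (tnth e i); rewrite pr_opZ basis_operator_unit mulr1.
Qed.

End Basis.

(** * One quasi-Newton iteration *)

Section Step.
Context (R : realType) (E : vectType R).
Variables (f : E -> R) (M : R).
Hypotheses (f2 : twice_differentiable f) (M0 : 0 <= M).
Hypothesis sc : strongly_self_concordant M f.
Hypothesis fpos : forall y : E, posdef (hessian f y).

Lemma gradient_norm_ge0 y : 0 <= gradient_norm f y.
Proof. exact: sqrtr_ge0. Qed.

Lemma gradient_norm_sqr y :
  gradient_norm f y ^+ 2 = pr (gradient f y) ((hessian f y)^-1%VF (gradient f y)).
Proof. by rewrite sqr_sqrtr//; apply: inv_ge0. Qed.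

Lemma local_norm_newton_direction y :
  local_norm f y ((hessian f y)^-1%VF (gradient f y)) = gradient_norm f y.
Proof. by rewrite local_normE posdefVK. Qed.

Lemma local_norm_le y z h (K : R) : loewner_le (hessian f y) (K *: hessian f z) ->
  forall a, 0 <= a -> K <= (1 + a) ^+ 2 ->
  local_norm f y h <= (1 + a) * local_norm f z h.
Proof.
move=> /loewnerP/(_ h); rewrite pr_opZ => yz a a0 Ka.
have zh : 0 <= pr (hessian f z h) h by exact: posdef_psd.
rewrite -(ler_pXn2r (n := 2)) ?nnegrE ?sqrtr_ge0//; last first.
  by rewrite mulr_ge0 ?sqrtr_ge0// addr_ge0.
rewrite (local_norm_sqr fpos y h) exprMn (local_norm_sqr fpos z h).
exact: (le_trans yz (ler_wpM2r zh Ka)).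
Qed.

Variables (x : E) (G : 'Hom(E, 'Hom(E, R^o))) (eta : R).
Let A := hessian f x.
Let g := gradient f x.
Let d := G^-1%VF g.
Let lam := gradient_norm f x.
Hypotheses (AG : loewner_le A G) (eta1 : 1 <= eta) (GA : loewner_le G (eta *: A)).
Hypothesis (Gs : selfadjoint G).

Let As : selfadjoint A. Proof. exact: selfadjoint_hessian. Qed.
Let Ap : posdef A. Proof. exact: fpos. Qed.
Let Gp : posdef G. Proof. exact: posdef_le AG. Qed.
Let AG1 : loewner_le A (1 *: G). Proof. by rewrite scale1r. Qed.
Let eta0 : 0 < eta. Proof. exact: lt_le_trans ltr01 eta1. Qed.

(** A <= G and G^-1 <= A^-1. *)
Lemma newton_step_length : local_norm f x (- d) <= lam.
Proof.
rewrite -(ler_pXn2r (n := 2)) ?nnegrE ?sqrtr_ge0//.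
rewrite local_norm_sqr// gradient_norm_sqr linearN prNl prNr opprK.
have := inv_antitone g As Ap Gp ler01 AG1; rewrite mul1r; apply: le_trans.
have -> : pr g (G^-1%VF g) = pr (G d) d by rewrite /d posdefVK.
by have /loewnerP/(_ d) := AG.
Qed.

Let Q := A - (A \o G^-1 \o A)%VF.

Let QE p h : pr (Q p) h = pr (A p) h - pr (A h) (G^-1%VF (A p)).
Proof. by rewrite /Q pr_opB !comp_lfunE (As (G^-1%VF (A p))). Qed.

(** With w = A^-1 g, the difference g - A d is Q w for Q = A - A G^-1 A, and
    0 <= Q <= (1 - 1 / eta) A since A^-1 / eta <= G^-1 <= A^-1. *)
Lemma newton_direction_error h :
  `|pr g h - pr (A d) h| <= (1 - eta^-1) * (lam * local_norm f x h).
Proof.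
set w := A^-1%VF g.
have -> : pr g h - pr (A d) h = pr (Q w) h.
  by rewrite QE /w posdefVK// As.
have -> : lam = Num.sqrt (pr (A w) w) by rewrite /w posdefVK.
apply: form_abs_le => //.
- move=> p q; rewrite !QE As; congr (_ - _).
  exact: inv_selfadjoint.
- exact: posdef_psd.
- by rewrite subr_ge0 invf_le1.
move=> p; rewrite QE ger0_norm.
  have := inv_antitone (A p) Gs Gp Ap (ltW eta0) GA.
  rewrite posdefK// mulrBl mul1r lerD2l lerN2 mulrC => le1.
  by rewrite mulrC ler_pdivrMr.
have := inv_antitone (A p) As Ap Gp ler01 AG1.
by rewrite posdefK// mul1r subr_ge0.
Qed.

(** The new gradient is (g - A d) plus the linearisation error, so its norm dual to
    the old Hessian is at most (1 - 1 / eta + a) lambda; passing to the norm dual to the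
    new Hessian costs sqrt (1 + M r) <= 1 + a. *)
Lemma newton_step_decrease : gradient_norm f (x - d) <=
  (1 + M * lam / 2) * (1 - eta^-1 + M * lam / 2) * lam.
Proof.
set a := M * lam / 2; set r := local_norm f x (- d).
have lam0 : 0 <= lam by apply: gradient_norm_ge0.
have rl : r <= lam := newton_step_length.
have r0 : 0 <= r by apply: sqrtr_ge0.
have a0 : 0 <= a by rewrite divr_ge0// mulr_ge0.
set c := 1 - eta^-1 + a.
have c0 : 0 <= c by rewrite addr_ge0// subr_ge0 invf_le1.
have grad_le h : `|pr (gradient f (x - d)) h| <= c * lam * local_norm f x h.
  have e1 := gradient_error f2 M0 sc fpos x (- d) h; rewrite -/r in e1.
  have e2 := newton_direction_error h.
  have -> : pr (gradient f (x - d)) h =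
     (pr (gradient f (x - d)) h - pr g h - pr (A (- d)) h) + (pr g h - pr (A d) h).
    rewrite linearN prNl.
    by move: (pr (gradient f (x - d)) h) (pr g h) (pr (A d) h) => X Y Z; ring.
  apply: (le_trans (ler_normD _ _)); apply: (le_trans (lerD e1 e2)).
  rewrite mulrA (mulrA (1 - _)) -mulrDl ler_wpM2r ?sqrtr_ge0//.
  rewrite /c [X in _ <= X]mulrDl addrC lerD2l /a.
  apply: ler_pM => //; first by rewrite divr_ge0// mulr_ge0.
  by rewrite ler_pM2r// ler_wpM2l.
have factor : 1 + M * r <= (1 + a) ^+ 2.
  have Mr : M * r <= M * lam := ler_wpM2l M0 rl.
  have -> : (1 + a) ^+ 2 = 1 + M * lam + a ^+ 2 by rewrite /a; field.
  by rewrite -addrA lerD2l (le_trans Mr)// lerDl sqr_ge0.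
have := grad_le ((hessian f (x - d))^-1%VF (gradient f (x - d))).
have [+ _] := hessian_step sc x (- d); rewrite -/r.
move=> /(local_norm_le ((hessian f (x - d))^-1%VF (gradient f (x - d)))).
rewrite (local_norm_newton_direction (x - d)) -(gradient_norm_sqr (x - d)).
rewrite ger0_norm ?sqr_ge0//.
clearbody a c r lam; clear -a0 c0 lam0 factor.
set lam' := gradient_norm f _; have : 0 <= lam' by exact: gradient_norm_ge0.
move: lam' (local_norm f x _) => lam' m lam'0.
move=> /(_ _ a0 factor) m_le sq_le.
have [->|l'] := eqVneq lam' 0; first by rewrite !mulr_ge0// addr_ge0.
have {l'} l' : 0 < lam' by rewrite lt_neqAle eq_sym l'.
rewrite -(ler_pM2r l') -expr2 (le_trans sq_le)//.
have -> : (1 + a) * c * lam * lam' = c * lam * ((1 + a) * lam') by ring.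
by rewrite ler_wpM2l// mulr_ge0.
Qed.

End Step.

(** * Scalar estimates *)

Section Scalar.
Context (R : realType).
Implicit Types (a b q eta sigma theta rho lam : R).

(** Here q = mu / L.  The slack between 2 / 3 and 1 / 2 absorbs the terms in a. *)
Lemma linear_factor_le a q eta : 0 <= a -> 0 < q -> q <= 1 -> a <= q / 40 ->
  1 <= eta -> eta <= 3 / 2 / q -> (1 + a) * (1 - eta^-1 + a) <= 1 - q / 2.
Proof.
move=> a0 q0 q1 aq eta1 etaq.
have : 2 / 3 * q <= eta^-1.
  rewrite -[2 / 3 * q]invrK lef_pV2 ?posrE ?invr_gt0; [|lra|lra].
  by apply: (le_trans etaq); rewrite invfM invf_div.
by move: (eta^-1) => w wq; nra.
Qed.

Lemma superlinear_factor_le a sigma : 0 <= a -> a <= 1 -> 0 <= sigma ->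
  (1 + a) * (1 - (1 + sigma)^-1 + a) <= sigma + 4 * a.
Proof.
move=> a0 a1 s0.
have s10 : 0 < 1 + sigma by lra.
have : 1 - (1 + sigma)^-1 <= sigma.
  have -> : 1 - (1 + sigma)^-1 = sigma / (1 + sigma) by field; lra.
  by rewrite ler_pdivrMr//; nra.
have : 1 - (1 + sigma)^-1 <= 1 by rewrite gerBl invr_ge0 ltW.
by move: (1 - _) => w ? ?; nra.
Qed.

Lemma one_plus_sqr_le_expR b : 0 <= b -> (1 + b) ^+ 2 <= expR (2 * b).
Proof.
move=> b0; rewrite expRM_natl lerXn2r ?nnegrE ?expR_ge0 ?expR_ge1Dx//.
by rewrite addr_ge0.
Qed.

(** With b = M lambda and c = M r, the change of target contributes (1 + b)^2 and
    the new gradient norm contributes 1 + 4 n b, hence the exponent 2 b + 4 n b.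
    The factor rho, absent from the bound on b', is recovered from 1 <= 2 rho. *)
Lemma potential_step (n : nat) b c sigma rho sigma' b' :
  0 <= c -> c <= b -> 0 <= sigma -> 1 / 2 <= rho ->
  sigma' <= rho * ((1 + c) ^+ 2 * (sigma + n%:R) - n%:R) ->
  b' <= (sigma + 2 * n%:R * b) * b ->
  sigma' + 2 * n%:R * b' <=
    rho * expR (2 * (2 * n%:R + 1) * b) * (sigma + 2 * n%:R * b).
Proof.
move=> c0 cb s0 rho2 s'le b'le.
have n0 : 0 <= n%:R :> R by rewrite ler0n.
have b0 : 0 <= b by exact: le_trans cb.
have nb0 : 0 <= n%:R * b by rewrite mulr_ge0.
have e1 := one_plus_sqr_le_expR b0.
have e2 := expR_ge1Dx (4 * n%:R * b).
have -> : 2 * (2 * n%:R + 1) * b = 2 * b + 4 * n%:R * b by ring.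
rewrite expRD; set theta := sigma + 2 * n%:R * b.
have th0 : 0 <= theta by rewrite /theta; nra.
have sq1 : 1 <= (1 + b) ^+ 2 by nra.
have k1 : (1 + c) ^+ 2 * (sigma + n%:R) - n%:R <= (1 + b) ^+ 2 * theta.
  have cb2 : (1 + c) ^+ 2 <= (1 + b) ^+ 2 by nra.
  have : (1 + c) ^+ 2 * (sigma + n%:R) <= (1 + b) ^+ 2 * (sigma + n%:R).
    by rewrite ler_wpM2r// addr_ge0.
  have : n%:R * b <= n%:R * b * (1 + b) ^+ 2 by rewrite ler_peMr.
  rewrite /theta; move: (n%:R : R) n0 nb0 => N N0 Nb0.
  have : 0 <= N * b * b by rewrite mulr_ge0.
  by nra.
have k2 : 2 * n%:R * b' <= rho * (4 * n%:R * b) * ((1 + b) ^+ 2 * theta).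
  have h1 : 2 * n%:R * b' <= 2 * (n%:R * b) * theta.
    have := ler_wpM2l n0 b'le; rewrite -/theta; lra.
  apply: (le_trans h1).
  have h2 : 2 * (n%:R * b) <= rho * (4 * n%:R * b) by nra.
  apply: ler_pM => //; first by rewrite mulr_ge0.
  by rewrite ler_peMl.
have rho0 : 0 <= rho by lra.
have k3 : rho * ((1 + b) ^+ 2 * theta) + rho * (4 * n%:R * b) * ((1 + b) ^+ 2 * theta)
   <= rho * (expR (2 * b) * expR (4 * n%:R * b)) * theta.
  have -> : rho * ((1 + b) ^+ 2 * theta) + rho * (4 * n%:R * b) * ((1 + b) ^+ 2 * theta)
    = rho * ((1 + b) ^+ 2 * (1 + 4 * n%:R * b)) * theta by ring.
  rewrite ler_wpM2r// ler_wpM2l// ler_pM//; first exact: sqr_ge0.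
  by rewrite addr_ge0// -mulrA mulr_ge0.
apply: le_trans k3; apply: lerD k2.
by apply: (le_trans s'le); rewrite ler_wpM2l.
Qed.

Lemma shifted_ratio_le (ai au gi gu c : R) : 0 < ai -> 0 < au -> 0 <= c ->
  gi / ai <= gu / au -> c * gi - ai <= (c * gu - au) / au * ai.
Proof.
move=> ai0 au0 c0; rewrite ler_pdivrMr// => gle.
have -> : (c * gu - au) / au * ai = c * (gu / au * ai) - ai by field; lra.
by rewrite lerD2r ler_wpM2l.
Qed.

Lemma scale_chain_le (c eta a a' g : R) : 0 <= c -> 0 <= eta ->
  g <= eta * a -> a <= c * a' -> c * g <= c ^+ 2 * eta * a'.
Proof.
move=> c0 eta0 ga aa'.
have -> : c ^+ 2 * eta * a' = c * (eta * (c * a')) by ring.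
by rewrite ler_wpM2l// (le_trans ga)// ler_wpM2l.
Qed.

Lemma ln2_le1 : ln 2 <= 1 :> R.
Proof. by have := @le_ln1Dx R 1; rewrite -natr1 => -> //; lra. Qed.

(** For n >= 2 the accumulated factor in eta is at most 2^(1/5). *)
Lemma expR_ln2_5 : expR (ln 2 / 5) <= 3 / 2 :> R.
Proof.
rewrite -(ler_pXn2r (n := 5)) ?nnegrE ?expR_ge0 ?divr_ge0//.
rewrite -expRM_natl mulrC divfK ?pnatr_eq0// lnK ?posrE//.
by lra.
Qed.

End Scalar.

(** * Convergence of the scheme *)

Section Scheme.
Context (R : realType) (E : vectType R) (n : nat) (e : n.-tuple E).
Variables (f : E -> R) (M mu L : R).
Variables (x : nat -> E) (G : nat -> 'Hom(E, 'Hom(E, R^o))).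
Variables (u : nat -> E) (tau : nat -> R).
Hypotheses (hn : (2 <= n)%N) (hdim : \dim {:E} = n) (he : basis_of {:E} e).
Hypotheses (f2 : twice_differentiable f) (fpos : forall y : E, posdef (hessian f y)).
Hypotheses (M0 : 0 <= M) (sc : strongly_self_concordant M f).
Hypotheses (mu0 : 0 < mu) (L0 : 0 < L).
Hypothesis (muL : forall y : E,
       loewner_le (mu *: basis_operator e) (hessian f y) /\
       loewner_le (hessian f y) (L *: basis_operator e)).
Hypothesis (qn : quasi_newton M L e f x G u tau).
Hypothesis (greedy : forall k : nat, greedy_direction e f (x k.+1) (G k) (u k)).

Let A k := hessian f (x k).
Let lam k := gradient_norm f (x k).
Let sigma k := rel_trace (A k) (G k) - n%:R.
Let rate := 1 - mu / (n%:R * L).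

Let As k : selfadjoint (A k). Proof. exact: selfadjoint_hessian. Qed.
Let Ap k : posdef (A k). Proof. exact: fpos. Qed.
Let Bs : selfadjoint (basis_operator e). Proof. exact: basis_operator_selfadjoint. Qed.
Let Bp : posdef (basis_operator e). Proof. exact: basis_operator_posdef. Qed.
Let n0 : 0 < n%:R :> R. Proof. by rewrite ltr0n; apply: leq_trans hn. Qed.

Lemma mu_le_L : mu <= L.
Proof.
have i0 : 'I_n by apply: (@Ordinal _ 0); apply: leq_trans hn.
have [/loewnerP/(_ (tnth e i0)) + /loewnerP/(_ (tnth e i0))] := muL (x 0%N).
by rewrite !pr_opZ basis_operator_unit// !mulr1; apply: le_trans.
Qed.

Lemma rate_ge_half : 1 / 2 <= rate.
Proof.
have n2 : 2 <= n%:R :> R by rewrite ler_nat.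
have : mu / (n%:R * L) <= 1 / 2.
  have nL : 2 * L <= n%:R * L by rewrite ler_pM2r.
  by rewrite ler_pdivrMr ?mulr_gt0//; have := mu_le_L; lra.
by rewrite /rate; lra.
Qed.

Lemma basis_neq0 v : v \in e -> v != 0.
Proof.
by move=> /tnthP[i ->]; apply: contra_eq_neq (basis_operator_unit he i) => ->;
  rewrite pr0r eq_sym oner_eq0.
Qed.

Lemma rel_trace_diff k P : rel_trace (A k) (P - A k) = rel_trace (A k) P - n%:R.
Proof. by rewrite rel_traceB rel_trace_self// hdim. Qed.

Lemma sigma_ge0 k : selfadjoint (G k) -> loewner_le (A k) (G k) -> 0 <= sigma k.
Proof.
move=> Gs AG; rewrite /sigma -rel_trace_diff; apply: rel_trace_ge0 => //.
exact: selfadjointB.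
Qed.

Lemma le_one_plus_sigma k : selfadjoint (G k) -> loewner_le (A k) (G k) ->
  loewner_le (G k) ((1 + sigma k) *: A k).
Proof.
move=> Gs AG; apply/loewnerP => h.
have Ps := selfadjointB (@As k) Gs.
have Pp : psd (G k - A k) := AG.
have /loewnerP/(_ h) := le_rel_trace (@As k) (@Ap k) Ps Pp.
by rewrite rel_trace_diff pr_opB pr_opZ => Ph; rewrite pr_opZ mulrDl mul1r -lerBlDl.
Qed.

Let r k := local_norm f (x k) (x k.+1 - x k).

Lemma quasi_newton_step k : x k.+1 = x k - (G k)^-1%VF (gradient f (x k)).
Proof. by have [_ /(_ k)[]] := qn. Qed.

Lemma step_length_le k : selfadjoint (G k) -> loewner_le (A k) (G k) -> r k <= lam k.
Proof.
move=> Gs AG; rewrite /r quasi_newton_step addrC addKr.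
exact: newton_step_length.
Qed.

Lemma hessian_comparison k :
  loewner_le (A k) ((1 + M * r k) *: A k.+1) /\
  loewner_le (A k.+1) ((1 + M * r k) *: A k).
Proof.
have := hessian_step sc (x k) (x k.+1 - x k).
by have -> : x k + (x k.+1 - x k) = x k.+1 by rewrite addrC subrK.
Qed.

Lemma gradient_norm_decrease k eta : selfadjoint (G k) -> loewner_le (A k) (G k) ->
  1 <= eta -> loewner_le (G k) (eta *: A k) ->
  lam k.+1 <= (1 + M * lam k / 2) * (1 - eta^-1 + M * lam k / 2) * lam k.
Proof.
by move=> Gs AG eta1 GA; rewrite /lam quasi_newton_step; exact: newton_step_decrease.
Qed.

Section Update.
Variable k : nat.
Hypotheses (Gs : selfadjoint (G k)) (AG : loewner_le (A k) (G k)).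

Let c := 1 + M * r k.
Let Gt := c *: G k.

Let r0 : 0 <= r k. Proof. exact: sqrtr_ge0. Qed.
Let c1 : 1 <= c. Proof. by rewrite /c lerDl mulr_ge0. Qed.
Let c0 : 0 < c. Proof. exact: lt_le_trans ltr01 c1. Qed.
Let Gts : selfadjoint Gt. Proof. exact: selfadjointZ. Qed.
Let GE : G k.+1 = Broyd (tau k) Gt (A k.+1) (u k).
Proof. by have [_ /(_ k)[]] := qn. Qed.
Let tau01 : 0 <= tau k <= 1. Proof. by have [_ /(_ k)[]] := qn. Qed.
Let u0 : u k != 0. Proof. by apply: basis_neq0; have [] := greedy k. Qed.

Let AGt : loewner_le (A k.+1) Gt.
Proof.
apply/loewnerP => h; have [_ /loewnerP/(_ h)] := hessian_comparison k.
move=> /le_trans; apply; rewrite !pr_opZ ler_pM2l//.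
by have /loewnerP := AG.
Qed.

Lemma update_selfadjoint : selfadjoint (G k.+1).
Proof. by rewrite GE; apply: selfadjoint_Broyd. Qed.

Lemma update_ge : loewner_le (A k.+1) (G k.+1).
Proof. by rewrite GE; apply: Broyd_ge. Qed.

Lemma update_le eta : 1 <= eta -> loewner_le (G k) (eta *: A k) ->
  loewner_le (G k.+1) ((c ^+ 2 * eta) *: A k.+1).
Proof.
move=> eta1 GA; rewrite GE.
apply: Broyd_le; [exact: As|exact: Ap|exact: Gts|exact: AGt|exact: tau01|exact: u0| |].
  by rewrite -[1]mulr1 ler_pM// expr_ge1// ltW.
apply/loewnerP => h; rewrite pr_opZ pr_opZ.
apply: (scale_chain_le (a := pr (A k h) h) (ltW c0) (le_trans ler01 eta1)).
  by have /loewnerP/(_ h) := GA; rewrite pr_opZ.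
by have [/loewnerP/(_ h) + _] := hessian_comparison k; rewrite pr_opZ.
Qed.

Lemma greedy_max i : pr ((Gt - A k.+1) (tnth e i)) (tnth e i) <=
  pr ((Gt - A k.+1) (u k)) (u k) / pr (A k.+1 (u k)) (u k)
    * pr (A k.+1 (tnth e i)) (tnth e i).
Proof.
rewrite !pr_opB !pr_opZ; apply: shifted_ratio_le; [| |exact: ltW|].
- exact: (posdefP (@Ap k.+1) (basis_neq0 (mem_tnth i e))).
- exact: (posdefP (@Ap k.+1) u0).
by have [_ /(_ (tnth e i) (mem_tnth i e))] := greedy k.
Qed.

(** A greedy update contracts the trace excess over the new Hessian by [rate], and
    that excess exceeds the one over the old Hessian because of two factors
    [c], from the scaling of G and from the change of Hessian. *)
Lemma update_sigma_le :
  sigma k.+1 <= rate * (c ^+ 2 * (sigma k + n%:R) - n%:R).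
Proof.
set P := Gt - A k.+1.
have Ps : selfadjoint P by exact: selfadjointB.
have Pp : psd P := AGt.
have Au : 0 < pr (A k.+1 (u k)) (u k) := posdefP (@Ap k.+1) u0.
set ratio := pr (P (u k)) (u k) / pr (A k.+1 (u k)) (u k).
have ratio0 : 0 <= ratio by rewrite divr_ge0 ?Pp// ltW.
have [muA AL] := muL (x k.+1).
have := rel_trace_le_max_ratio he mu0 L0 (@As k.+1) (@Ap k.+1) Ps Pp muA AL
  greedy_max ratio0.
have := rel_trace_Broyd_le (@As k.+1) (@Ap k.+1) Gts AGt tau01 u0.
rewrite -GE -/P -/ratio rel_trace_diff.
have trG : rel_trace (A k.+1) Gt <= c ^+ 2 * (sigma k + n%:R).
  rewrite /sigma subrK rel_traceZ expr2 -mulrA ler_pM2l//.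
  exact: (rel_trace_antitone (@As k) (@Ap k) (@Ap k.+1) (ltW c0)
    (hessian_comparison k).1 Gs (posdef_psd (posdef_le (@Ap k) AG))).
rewrite /sigma; move: trG ratio0 rate_ge_half.
move: ratio (rel_trace _ Gt) (rel_trace _ (G k.+1)) (c ^+ 2 * _) => q T T' C TC q0 rho2.
move=> T'le Tle.
have nL : 0 < n%:R * L by rewrite mulr_gt0.
have {}Tle : mu / (n%:R * L) * (T - n%:R) <= q.
  have -> : q = mu / (n%:R * L) * (n%:R * L / mu * q) by field; rewrite !gt_eqF.
  by rewrite ler_wpM2l// divr_ge0// ltW.
apply: (@le_trans _ _ (rate * (T - n%:R))); first by rewrite /rate; lra.
by rewrite ler_wpM2l ?lerD2r//; apply: le_trans rho2; rewrite divr_ge0.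
Qed.

End Update.

Hypothesis start : M * lam 0 <= ln 2 / (4 * (2 * n%:R + 1)) * (mu / L).

Let S k := \sum_(i < k) lam i.
Let eta k := expR (2 * (M * S k)) * (L / mu).
Let theta k := sigma k + 2 * n%:R * (M * lam k).

Let lam_ge0 k : 0 <= lam k. Proof. exact: gradient_norm_ge0. Qed.
Let S_ge0 k : 0 <= S k. Proof. exact: sumr_ge0. Qed.
Let q_gt0 : 0 < mu / L. Proof. exact: divr_gt0. Qed.
Let q_le1 : mu / L <= 1. Proof. by rewrite ler_pdivrMr// mul1r mu_le_L. Qed.
Let Lmu_ge0 : 0 <= 2 * (L / mu).
Proof. by rewrite mulr_ge0 ?divr_ge0 ?ltW. Qed.
Let N5 : 5 <= 2 * n%:R + 1 :> R.
Proof. by have : 2 <= n%:R :> R by [rewrite ler_nat]; lra. Qed.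

(** The exponentials collect the factors lost in the first [k] changes of target, and
    [inv_sum] is the summed form of the linear decrease of the gradient norms:
    lambda_i <= (2 L / mu) (lambda_i - lambda_(i+1)). *)
Record invariant k : Prop := Invariant {
  inv_sym : selfadjoint (G k);
  inv_ge : loewner_le (A k) (G k);
  inv_le : loewner_le (G k) (eta k *: A k);
  inv_sum : S k + 2 * (L / mu) * lam k <= 2 * (L / mu) * lam 0;
  inv_theta : theta k <=
    rate ^+ k * expR (2 * (2 * n%:R + 1) * (M * S k)) * (n%:R * L / mu)
}.

Lemma ln2_ge0 : 0 <= ln 2 :> R. Proof. by rewrite ln_ge0// ler1n. Qed.

(** The assumption on the starting point, spent on the whole sum of gradient norms;
    twice (2 n + 1) times this bound is ln 2. *)
Lemma sum_bound k : invariant k -> M * S k <= ln 2 / (2 * (2 * n%:R + 1)).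
Proof.
move=> I; have H : S k <= 2 * (L / mu) * lam 0.
  by apply: le_trans (inv_sum I); rewrite lerDl mulr_ge0.
have := ler_wpM2l M0 H => /le_trans; apply.
have -> : M * (2 * (L / mu) * lam 0) = M * lam 0 * (2 * (L / mu)) by ring.
have -> : ln 2 / (2 * (2 * n%:R + 1)) =
    ln 2 / (4 * (2 * n%:R + 1)) * (mu / L) * (2 * (L / mu)).
  by field; rewrite !gt_eqF//; have := N5; lra.
by rewrite ler_wpM2r.
Qed.

Lemma eta_bound k : invariant k -> eta k <= 3 / 2 / (mu / L).
Proof.
move=> I; rewrite invf_div /eta ler_wpM2r ?divr_ge0 ?(ltW mu0) ?(ltW L0)//.
apply: le_trans (expR_ln2_5 R); rewrite ler_expR.
have := ler_wpM2l (ler0n R 2) (sum_bound I) => /le_trans; apply.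
have -> : 2 * (ln 2 / (2 * (2 * n%:R + 1))) = ln 2 / (2 * n%:R + 1) :> R.
  by field; rewrite gt_eqF//; have := N5; lra.
by rewrite ler_wpM2l ?ln2_ge0// lef_pV2 ?posrE//; have := N5; lra.
Qed.

Lemma exp_bound k : invariant k -> expR (2 * (2 * n%:R + 1) * (M * S k)) <= 2.
Proof.
move=> I; have e2 : expR (ln 2) = 2 :> R by rewrite lnK ?posrE.
have N0 : 0 < 2 * (2 * n%:R + 1) :> R by have := N5; lra.
by rewrite -[X in _ <= X]e2 ler_expR mulrC -ler_pdivlMr//; exact: sum_bound.
Qed.

Lemma lam_bound k : invariant k -> M * lam k / 2 <= mu / L / 40.
Proof.
move=> I; have H : lam k <= lam 0.
  have Lmu : 0 < 2 * (L / mu) by rewrite mulr_gt0// divr_gt0.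
  rewrite -(ler_pM2l Lmu); apply: le_trans (inv_sum I).
  by rewrite lerDr.
have H0 : M * lam 0 <= 1 / 20 * (mu / L).
  apply: (le_trans start); apply: (ler_wpM2r (ltW q_gt0)).
  by rewrite ler_pdivrMr; have := ln2_le1 R; have := N5; lra.
have := ler_wpM2l M0 H; lra.
Qed.

Lemma eta_ge1 k : 1 <= eta k.
Proof.
rewrite -[1]mulr1 ler_pM//.
  by rewrite -expR0 ler_expR !mulr_ge0.
by rewrite ler_pdivlMr// mul1r mu_le_L.
Qed.

Lemma lam_step_linear k : invariant k -> lam k.+1 <= (1 - mu / L / 2) * lam k.
Proof.
move=> I.
have dec := gradient_norm_decrease (inv_sym I) (inv_ge I) (eta_ge1 k) (inv_le I).
apply: (le_trans dec).
rewrite ler_wpM2r// linear_factor_le ?eta_ge1 ?eta_bound ?lam_bound//.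
by rewrite divr_ge0// mulr_ge0.
Qed.

(** The decrease estimate with 1 + sigma in the place of eta. *)
Lemma lam_step_superlinear k : invariant k -> lam k.+1 <= theta k * lam k.
Proof.
move=> I; have s0 := sigma_ge0 (inv_sym I) (inv_ge I).
have s1 : 1 <= 1 + sigma k by rewrite lerDl.
have dec := gradient_norm_decrease (inv_sym I) (inv_ge I) s1
  (le_one_plus_sigma (inv_sym I) (inv_ge I)).
apply: (le_trans dec).
have b0 : 0 <= M * lam k by rewrite mulr_ge0.
rewrite ler_wpM2r//; apply: le_trans (superlinear_factor_le _ _ s0) _.
- by rewrite divr_ge0.
- by have := lam_bound I; have := q_le1; lra.
rewrite /theta lerD2l; have n2 : 2 <= n%:R :> R by rewrite ler_nat.
by have := ler_wpM2r b0 n2; lra.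
Qed.

Lemma invariant0 : invariant 0.
Proof.
have G0 : G 0%N = L *: basis_operator e by have [] := qn.
have S0 : S 0 = 0 by rewrite /S big_ord0.
have [muA AL] := muL (x 0%N).
split.
- by rewrite G0; exact: selfadjointZ.
- by rewrite G0.
- rewrite G0 /eta S0 !mulr0 expR0 mul1r; apply/loewnerP => h; rewrite !pr_opZ.
  rewrite -mulrA ler_pM2l// mulrC ler_pdivlMr// mulrC -pr_opZ.
  by have /loewnerP := muA.
- by rewrite S0 add0r.
rewrite S0 !mulr0 expR0 expr0 !mul1r /theta /sigma G0 rel_traceZ.
have : rel_trace (A 0) (basis_operator e) <= mu^-1 * n%:R.
  have mu_inv : 0 <= mu^-1 by rewrite invr_ge0 ltW.
  have BA : loewner_le (basis_operator e) (mu^-1 *: A 0).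
    apply/loewnerP => h; rewrite pr_opZ mulrC ler_pdivlMr// mulrC -pr_opZ.
    by have /loewnerP := muA.
  have -> : n%:R = rel_trace (basis_operator e) (basis_operator e).
    by rewrite rel_trace_self// hdim.
  exact: (rel_trace_antitone Bs Bp (@Ap 0) mu_inv BA Bs (posdef_psd Bp)).
move=> /(ler_wpM2l (ltW L0)) trB.
have H0 : M * lam 0 <= 1 / 2.
  apply: (le_trans start); apply: (@le_trans _ _ (ln 2 / (4 * (2 * n%:R + 1)) * 1)).
    by rewrite ler_wpM2l ?divr_ge0 ?ln2_ge0//; have := N5; lra.
  rewrite mulr1 ler_pdivrMr; last by have := N5; lra.
  by have := ln2_le1 R; have := N5; lra.
have := ler_wpM2l (ltW n0) H0; move: trB.
have -> : L * (mu^-1 * n%:R) = n%:R * L / mu by ring.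
by lra.
Qed.

Lemma invariantS k : invariant k -> invariant k.+1.
Proof.
move=> I; have [Gs AG GA sum_le th_le] := I.
have SS : S k.+1 = S k + lam k by rewrite /S big_ord_recr.
have rl := step_length_le Gs AG.
have r0 : 0 <= r k by exact: sqrtr_ge0.
have Mr0 : 0 <= M * r k by rewrite mulr_ge0.
have Mrl : M * r k <= M * lam k by rewrite ler_wpM2l.
have b0 : 0 <= M * lam k by exact: le_trans Mrl.
split.
- exact: update_selfadjoint.
- exact: update_ge.
- have := update_le Gs AG (eta_ge1 k) GA => /loewnerP Gle; apply/loewnerP => h.
  apply: (le_trans (Gle h)); rewrite pr_opZ pr_opZ.
  apply: (ler_wpM2r (posdef_psd (@Ap k.+1) h)).
  rewrite /eta [X in X <= _]mulrA; apply: ler_wpM2r.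
    by rewrite divr_ge0 ?(ltW L0) ?(ltW mu0).
  rewrite SS [M * (_ + _)]mulrDr [2 * (_ + _)]mulrDr expRD mulrC.
  apply: (ler_wpM2l (expR_ge0 _)).
  apply: le_trans (one_plus_sqr_le_expR b0).
  by rewrite lerXn2r ?nnegrE ?addr_ge0// lerD2l.
- apply: le_trans sum_le; rewrite SS -addrA lerD2l.
  have := ler_wpM2l Lmu_ge0 (lam_step_linear I).
  have -> : 2 * (L / mu) * ((1 - mu / L / 2) * lam k) = 2 * (L / mu) * lam k - lam k.
    by field; rewrite !gt_eqF.
  by lra.
have step : theta k.+1 <= rate * expR (2 * (2 * n%:R + 1) * (M * lam k)) * theta k.
  apply: (potential_step Mr0 Mrl) => //.
  - exact: sigma_ge0.
  - exact: rate_ge_half.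
  - exact: update_sigma_le.
  - by rewrite mulrCA; have := ler_wpM2l M0 (lam_step_superlinear I); rewrite /theta.
apply: (le_trans step).
have -> : rate ^+ k.+1 * expR (2 * (2 * n%:R + 1) * (M * S k.+1)) * (n%:R * L / mu)
  = rate * expR (2 * (2 * n%:R + 1) * (M * lam k))
    * (rate ^+ k * expR (2 * (2 * n%:R + 1) * (M * S k)) * (n%:R * L / mu)).
  by rewrite SS (mulrDr M) (mulrDr (2 * (2 * n%:R + 1))) expRD exprS; ring.
rewrite ler_wpM2l// mulr_ge0 ?expR_ge0//.
by apply: le_trans rate_ge_half; rewrite divr_ge0.
Qed.

Lemma invariant_holds k : invariant k.
Proof. by elim: k => [|k]; [exact: invariant0 | exact: invariantS]. Qed.

Lemma theta_le k : theta k <= rate ^+ k * (2 * n%:R * L / mu).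
Proof.
have I := invariant_holds k; apply: (le_trans (inv_theta I)).
have -> : rate ^+ k * (2 * n%:R * L / mu) = rate ^+ k * 2 * (n%:R * L / mu) by ring.
have rate0 : 0 <= rate by apply: le_trans rate_ge_half; rewrite divr_ge0.
by rewrite ler_wpM2r ?ler_wpM2l ?exp_bound ?exprn_ge0// divr_ge0 ?mulr_ge0// ltW.
Qed.

Lemma approximation_le k :
  loewner_le (G k) ((1 + rate ^+ k * (2 * n%:R * L / mu)) *: A k).
Proof.
have I := invariant_holds k; apply/loewnerP => h.
have /loewnerP/(_ h) := le_one_plus_sigma (inv_sym I) (inv_ge I).
move=> /le_trans; apply; rewrite pr_opZ pr_opZ.
apply: (ler_wpM2r (posdef_psd (@Ap k) h)); rewrite lerD2l.
by apply: le_trans (theta_le k); rewrite lerDl !mulr_ge0.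
Qed.

Lemma superlinear_convergence k :
  lam k.+1 <= rate ^+ k * (2 * n%:R * L / mu) * lam k.
Proof.
apply: (le_trans (lam_step_superlinear (invariant_holds k))).
exact: (ler_wpM2r (lam_ge0 k) (theta_le k)).
Qed.

End Scheme.

Theorem theorem4p9 (R : realType) (E : vectType R) (n : nat) (e : n.-tuple E)
    (f : E -> R) (M mu L : R)
    (x : nat -> E) (G : nat -> 'Hom(E, 'Hom(E, R^o)))
    (u : nat -> E) (tau : nat -> R)
    (hn : (2 <= n)%N) (hdim : \dim {:E} = n) (he : basis_of {:E} e)
    (hf2 : twice_differentiable f)
    (hpos : forall y : E, posdef (hessian f y))
    (hM : 0 <= M)
    (hsc : strongly_self_concordant M f)
    (hmu : 0 < mu) (hL : 0 < L)
    (hmuL : forall y : E,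
       loewner_le (mu *: basis_operator e) (hessian f y) /\
       loewner_le (hessian f y) (L *: basis_operator e))
    (hqn : quasi_newton M L e f x G u tau)
    (hgreedy : forall k : nat, greedy_direction e f (x k.+1) (G k) (u k))
    (hx0 : M * gradient_norm f (x 0%N)
             <= ln 2 / (4 * (2 * n%:R + 1)) * (mu / L)) :
  forall k : nat,
    (loewner_le (hessian f (x k)) (G k) /\
     loewner_le (G k)
       ((1 + (1 - mu / (n%:R * L)) ^+ k * (2 * n%:R * L / mu))
          *: hessian f (x k))) /\
    gradient_norm f (x k.+1)
      <= (1 - mu / (n%:R * L)) ^+ k * (2 * n%:R * L / mu)
           * gradient_norm f (x k).
Proof.
move=> k; split; last first.
  exact: (superlinear_convergence hn hdim he hf2 hpos hM hsc hmu hL hmuL hqn hgreedy hx0).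
split; last first.
  exact: (approximation_le hn hdim he hf2 hpos hM hsc hmu hL hmuL hqn hgreedy hx0).
exact: (inv_ge (invariant_holds hn hdim he hf2 hpos hM hsc hmu hL hmuL hqn hgreedy hx0 k)).
Qed.
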